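(* Let $S$ be an integral domain and let $\mathcal A_{n,S,r}(u_1,\dots,u_r)$ be the cyclotomic BMW algebras (parameters $\rho,q,\Omega,u_1,\dots,u_r$) or the degenerate cyclotomic BMW algebras (parameters $\Omega,u_1,\dots,u_r$) over $S$, where $\Omega=(\omega_a)_{a\ge0}$. Assume that the left ideal $\mathcal A_{2,S,r}(u_1,\dots,u_r)\,e_1$ is torsion free over $S$, that the parameters are $d$-semi-admissible with $0<d<r$, and that $p_0(y_1)e_1=0$ in $\mathcal A_{2,S,r}(u_1,\dots,u_r)$, where $p_0(u)=(u-u_1)\cdots(u-u_d)=\sum_{j=0}^db_ju^j$. Then: (1) The sequence $\Omega$ satisfies the recurrence relation $\sum_{j=0}^db_j\omega_{j+\ell}=0$ for all $\ell\ge0$. (2) The parameters $\Omega$ and $u_1,\dots,u_d$ in the degenerate case (respectively $\rho,q,\Omega$ and $u_1,\dots,u_d$ in the non-degenerate case) are admissible. That is, the set $\{e_1,y_1e_1,\dots,y_1^{d-1}e_1\}$ is linearly independent over $S$ in $\mathcal A_{2,S,d}(u_1,\dots,u_d)$.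
   Context: **Degenerate algebras.** Let $n\ge1$, $S$ a commutative ring with $1$, $\Omega=(\omega_a)_{a\ge0}$ a sequence in $S$. The degenerate affine BMW algebra $\widehat{\mathcal N}_{n,S}(\Omega)$ is the unital associative $S$-algebra with generators $s_i,e_i$ ($1\le i<n$), $y_j$ ($1\le j\le n$) and relations (for all indices for which they make sense): (1) $s_i^2=1$; (2) $s_is_j=s_js_i$ if $|i-j|>1$, $s_is_{i+1}s_i=s_{i+1}s_is_{i+1}$, $s_iy_j=y_js_i$ if $j\ne i,i+1$; (3) $e_i^2=\omega_0e_i$; (4) $e_1y_1^ae_1=\omega_ae_1$ for $a>0$; (5) $s_ie_j=e_js_i$ and $e_ie_j=e_je_i$ if $|i-j|>1$, $e_iy_j=y_je_i$ if $j\ne i,i+1$, $y_iy_j=y_jy_i$; (6) $e_is_i=e_i=s_ie_i$, $s_ie_{i+1}e_i=s_{i+1}e_i$, $e_ie_{i+1}s_i=e_is_{i+1}$, $e_{i+1}e_is_{i+1}=e_{i+1}s_i$, $s_{i+1}e_ie_{i+1}=s_ie_{i+1}$, $e_{i+1}e_ie_{i+1}=e_{i+1}$, $e_ie_{i+1}e_i=e_i$; (7) $s_iy_i-y_{i+1}s_i=e_i-1$, $y_is_i-s_iy_{i+1}=e_i-1$; (8) $e_i(y_i+y_{i+1})=0=(y_i+y_{i+1})e_i$. For $r\ge1$ and $u_1,\dots,u_r\in S$, the degenerate cyclotomic BMW algebra $\mathcal N_{n,S,r}(\Omega;u_1,\dots,u_r)$ is the quotient of $\widehat{\mathcal N}_{n,S}(\Omega)$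 by the relation $(y_1-u_1)\cdots(y_1-u_r)=0$. **Non-degenerate algebras.** Let $\rho,q\in S$ be invertible and $\Omega=(\omega_a)_{a\ge0}$ a sequence in $S$ with $\rho^{-1}-\rho=(q^{-1}-q)(\omega_0-1)$. The affine BMW algebra $\widehat{\mathcal W}_{n,S}(\rho,q,\Omega)$ is the unital associative $S$-algebra with generators $y_1^{\pm1}$, $g_i^{\pm1}$, $e_i$ ($1\le i\le n-1$) and relations: (1) $g_ig_i^{-1}=g_i^{-1}g_i=1$, $y_1y_1^{-1}=y_1^{-1}y_1=1$; (2) $g_ig_{i+1}g_i=g_{i+1}g_ig_{i+1}$, $g_ig_j=g_jg_i$ if $|i-j|\ge2$, $y_1g_1y_1g_1=g_1y_1g_1y_1$, $y_1g_j=g_jy_1$ if $j\ge2$; (3) $e_i^2=\omega_0e_i$; (4) $e_1y_1^je_1=\omega_je_1$ for $j\ge1$; (5) $g_ie_j=e_jg_i$ and $e_ie_j=e_je_i$ if $|i-j|\ge2$, $y_1e_j=e_jy_1$ if $j\ge2$; (6) $g_ie_i=e_ig_i=\rho^{-1}e_i$, $e_ig_{i\pm1}e_i=\rho e_i$, $e_ie_{i\pm1}e_i=e_i$, $g_ig_{i\pm1}e_i=e_{i\pm1}e_i$, $e_ig_{i\pm1}g_i=e_ie_{i\pm1}$; (7) $g_i-g_i^{-1}=(q-q^{-1})(1-e_i)$; (8) $e_1y_1g_1y_1g_1=e_1=g_1y_1g_1y_1e_1$. For $r\ge1$ and invertible $u_1,\dots,u_r\in S$, the cyclotomic BMW algebra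 $\mathcal W_{n,S,r}(\rho,q,\Omega;u_1,\dots,u_r)$ is the quotient of $\widehat{\mathcal W}_{n,S}(\rho,q,\Omega)$ by $(y_1-u_1)\cdots(y_1-u_r)=0$. $\mathcal A_{n,S,r}(u_1,\dots,u_r)$ denotes either $\mathcal W_{n,S,r}(\rho,q,\Omega;u_1,\dots,u_r)$ or $\mathcal N_{n,S,r}(\Omega;u_1,\dots,u_r)$; $\mathcal A_{n,S,d}(u_1,\dots,u_d)$ has the same $\rho,q,\Omega$ (resp. $\Omega$). The parameters are $d$-semi-admissible ($0<d<r$) if $\{e_1,y_1e_1,\dots,y_1^{d-1}e_1\}$ is linearly independent over $S$ in $\mathcal A_{2,S,r}(u_1,\dots,u_r)$ but $\{e_1,y_1e_1,\dots,y_1^de_1\}$ is linearly dependent. (Under the torsion-freeness assumption, after renumbering the $u_i$ one always has $(y_1-u_1)\cdots(y_1-u_d)e_1=0$; the numbering is assumed chosen this way.) *)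

(* Defs.v *)
From HB Require Import structures.
From mathcomp Require Import all_boot all_order all_algebra.
From mathcomp Require Import boolp monalg.

Set Implicit Arguments.
Unset Strict Implicit.
Unset Printing Implicit Defensive.

Import GRing.Theory.
Local Open Scope ring_scope.
Local Open Scope quotient_scope.

(* The free algebra on X is the monoid algebra of the free monoid on X. *)
Section FreeAlgebra.
Variables (S : comNzRingType) (X : choiceType).

Definition free_algebra := {malg S[{fmonom X}]}.

HB.instance Definition _ := GRing.Lalgebra.on free_algebra.

Fact free_scalerAr (c : S) (x y : free_algebra) : c *: (x * y) = x * (c *: y).
Proof.
have cC (z : {malg S[{fmonom X}]}) : c *: z = z * c%:MP.
  rewrite -mul_malgC !malgM_def fgmulUg fgmulgU.
  by apply: eq_bigr => k _; rewrite mulrC mul1m mulm1.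
by rewrite [LHS]cC [X in _ = _ * X]cC mulrA.
Qed.

HB.instance Definition _ :=
  GRing.Lalgebra_isAlgebra.Build S free_algebra free_scalerAr.

Definition free_gen (i : X) : free_algebra := << fmu i >>.

End FreeAlgebra.

(* Two-sided ideal generated by the differences x - y with R x y. *)
Inductive ideal_gen (A : pzRingType) (R : A -> A -> Prop) : A -> Prop :=
| ideal_gen_rel x y of R x y : ideal_gen R (x - y)
| ideal_gen0 : ideal_gen R 0
| ideal_genD x y of ideal_gen R x & ideal_gen R y : ideal_gen R (x + y)
| ideal_genM a b x of ideal_gen R x : ideal_gen R (a * x * b).

(* The quotient of an algebra by relations.  MathComp's algType demands 1 != 0,
   which cannot be known for arbitrary relations, so the quotient is only made a
   pzRingType and an lmodType S; that the two structures are compatible is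
   quot_scalerAl and quot_scalerAr. *)
Section Quotient.
Variables (S : comNzRingType) (A : algType S) (R : A -> A -> Prop).

Local Notation I := (ideal_gen R).

Lemma ideal_genMl a x : I x -> I (a * x).
Proof. by move=> Ix; rewrite -[a * x]mulr1; apply: ideal_genM. Qed.

Lemma ideal_genMr a x : I x -> I (x * a).
Proof. by move=> Ix; rewrite -[x]mul1r; apply: ideal_genM. Qed.

Lemma ideal_genN x : I x -> I (- x).
Proof. by move=> Ix; rewrite -mulN1r; apply: ideal_genMl. Qed.

Lemma ideal_genZ (c : S) x : I x -> I (c *: x).
Proof. by move=> Ix; rewrite -[x]mul1r scalerAl; apply: ideal_genMl. Qed.

Definition ideal_eqv : rel A := fun x y => `[< I (x - y) >].

Lemma ideal_eqv_is_equiv : equiv_class_of ideal_eqv.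
Proof.
split=> [x|x y|y x z].
- by apply/asboolP; rewrite subrr; apply: ideal_gen0.
- by apply/asboolP/asboolP=> /ideal_genN; rewrite opprB.
- move=> /asboolP xy /asboolP yz; apply/asboolP.
  by rewrite -(subrKA y); apply: ideal_genD.
Qed.

Canonical ideal_eqv_equiv := EquivRelPack ideal_eqv_is_equiv.

Definition quot_algebra := {eq_quot ideal_eqv}.

HB.instance Definition _ : EqQuotient A ideal_eqv quot_algebra :=
  EqQuotient.on quot_algebra.
HB.instance Definition _ := Choice.on quot_algebra.

Definition to_quot (x : A) : quot_algebra := \pi x.

Lemma to_quotP x y : to_quot x = to_quot y <-> I (x - y).
Proof. by split=> [/eqmodP/asboolP|xy] //; apply/eqmodP/asboolP. Qed.

Lemma to_quot_surj z : exists x, z = to_quot x.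
Proof. by exists (repr z); rewrite /to_quot reprK. Qed.

Definition quot_zero := to_quot 0.
Definition quot_one := to_quot 1.
Definition quot_opp (z : quot_algebra) : quot_algebra := to_quot (- repr z).
Definition quot_add (z t : quot_algebra) : quot_algebra :=
  to_quot (repr z + repr t).
Definition quot_mul (z t : quot_algebra) : quot_algebra :=
  to_quot (repr z * repr t).
Definition quot_scale (c : S) (z : quot_algebra) : quot_algebra :=
  to_quot (c *: repr z).

Lemma repr_to_quot x : I (repr (to_quot x) - x).
Proof. by apply/to_quotP; rewrite {1}/to_quot reprK. Qed.

Lemma quot_oppE x : quot_opp (to_quot x) = to_quot (- x).
Proof. by apply/to_quotP; rewrite -opprD; apply/ideal_genN/repr_to_quot. Qed.

Lemma quot_addE x y : quot_add (to_quot x) (to_quot y) = to_quot (x + y).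
Proof.
apply/to_quotP; rewrite opprD addrACA.
by apply: ideal_genD; apply: repr_to_quot.
Qed.

Lemma quot_mulE x y : quot_mul (to_quot x) (to_quot y) = to_quot (x * y).
Proof.
apply/to_quotP; rewrite -(subrKA (x * repr (to_quot y))) -mulrBl -mulrBr.
apply: ideal_genD; [apply: ideal_genMr | apply: ideal_genMl];
  exact: repr_to_quot.
Qed.

Lemma quot_scaleE c x : quot_scale c (to_quot x) = to_quot (c *: x).
Proof. by apply/to_quotP; rewrite -scalerBr; apply/ideal_genZ/repr_to_quot. Qed.

Local Notation quotE := (quot_oppE, quot_addE, quot_mulE, quot_scaleE).

Ltac quot_law :=
  repeat (let z := fresh "z" in move=> z;
    try (have [? ->] := to_quot_surj z; clear z));
  rewrite /quot_zero /quot_one ?quotE; congr to_quot.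

Fact quot_addA : associative quot_add.
Proof. by quot_law; rewrite addrA. Qed.
Fact quot_addC : commutative quot_add.
Proof. by quot_law; rewrite addrC. Qed.
Fact quot_add0 : left_id quot_zero quot_add.
Proof. by quot_law; rewrite add0r. Qed.
Fact quot_addN : left_inverse quot_zero quot_opp quot_add.
Proof. by quot_law; rewrite addNr. Qed.

HB.instance Definition _ :=
  GRing.isZmodule.Build quot_algebra quot_addA quot_addC quot_add0 quot_addN.

Fact quot_mulA : associative quot_mul.
Proof. by quot_law; rewrite mulrA. Qed.
Fact quot_mul1 : left_id quot_one quot_mul.
Proof. by quot_law; rewrite mul1r. Qed.
Fact quot_mulr1 : right_id quot_one quot_mul.
Proof. by quot_law; rewrite mulr1. Qed.
Fact quot_mulDl : left_distributive quot_mul quot_add.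
Proof. by quot_law; rewrite mulrDl. Qed.
Fact quot_mulDr : right_distributive quot_mul quot_add.
Proof. by quot_law; rewrite mulrDr. Qed.

HB.instance Definition _ := GRing.Zmodule_isPzRing.Build quot_algebra
  quot_mulA quot_mul1 quot_mulr1 quot_mulDl quot_mulDr.

Fact quot_scaleA a b z : quot_scale a (quot_scale b z) = quot_scale (a * b) z.
Proof. by have [x ->] := to_quot_surj z; rewrite !quotE scalerA. Qed.
Fact quot_scale1 : left_id 1 quot_scale.
Proof. by quot_law; rewrite scale1r. Qed.
Fact quot_scaleDr : right_distributive quot_scale +%R.
Proof.
move=> c z t; have [x ->] := to_quot_surj z; have [y ->] := to_quot_surj t.
by rewrite -![_ + _]/(quot_add _ _) !quotE scalerDr.
Qed.
Fact quot_scaleDl z : {morph quot_scale^~ z : a b / a + b}.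
Proof.
move=> a b /=; have [x ->] := to_quot_surj z.
by rewrite -[RHS]/(quot_add _ _) !quotE scalerDl.
Qed.

HB.instance Definition _ := GRing.Zmodule_isLmodule.Build S quot_algebra
  quot_scaleA quot_scale1 quot_scaleDr quot_scaleDl.

Fact quot_scalerAl (c : S) (z t : quot_algebra) : c *: (z * t) = (c *: z) * t.
Proof.
have [x ->] := to_quot_surj z; have [y ->] := to_quot_surj t.
rewrite -[LHS]/(quot_scale _ (quot_mul _ _)).
by rewrite -[RHS]/(quot_mul (quot_scale _ _) _) !quotE scalerAl.
Qed.
Fact quot_scalerAr (c : S) (z t : quot_algebra) : c *: (z * t) = z * (c *: t).
Proof.
have [x ->] := to_quot_surj z; have [y ->] := to_quot_surj t.
rewrite -[LHS]/(quot_scale _ (quot_mul _ _)).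
by rewrite -[RHS]/(quot_mul _ (quot_scale _ _)) !quotE scalerAr.
Qed.

Lemma to_quot0 : to_quot 0 = 0. Proof. by []. Qed.
Lemma to_quot1 : to_quot 1 = 1. Proof. by []. Qed.
Lemma to_quotN : {morph to_quot : x / - x}.
Proof. by move=> x; rewrite -quot_oppE. Qed.
Lemma to_quotD : {morph to_quot : x y / x + y}.
Proof. by move=> x y; rewrite -quot_addE. Qed.
Lemma to_quotM : {morph to_quot : x y / x * y}.
Proof. by move=> x y; rewrite -quot_mulE. Qed.
Lemma to_quotZ c : {morph to_quot : x / c *: x}.
Proof. by move=> x; rewrite -quot_scaleE. Qed.

End Quotient.

(* Indices are 0-based: the ordinal of value k stands for the index k + 1 of the
   usual numbering.  The y_j with 1 <= j <= n are indexed by 'I_n.-1.+1, which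
   is 'I_n for the relevant n >= 1 (n = 0 gives the same algebras as n = 1). *)
Definition far m (i j : 'I_m) := (i.+1 < j)%N || (j.+1 < i)%N.
Definition adjacent m (i j : 'I_m) := (j == i.+1 :> nat) || (i == j.+1 :> nat).

(* For the index i of s_i, e_i: the indices of y_i and of y_{i+1}. *)
Definition lo m (i : 'I_m) : 'I_m.+1 := widen_ord (leqnSn m) i.
Definition hi m (i : 'I_m) : 'I_m.+1 := lift ord0 i.

Section Degenerate.
Variables (n : nat) (S : comNzRingType) (omega : nat -> S).

Definition dBMW_gen : choiceType := ('I_n.-1 + 'I_n.-1 + 'I_n.-1.+1)%type.

Local Notation F := (free_algebra S dBMW_gen).
Local Notation s i := (free_gen S (inl (inl i) : dBMW_gen)).
Local Notation e i := (free_gen S (inl (inr i) : dBMW_gen)).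
Local Notation y k := (free_gen S (inr k : dBMW_gen)).

Inductive dBMW_rel : F -> F -> Prop :=
| dBMW_ss (i : 'I_n.-1) : dBMW_rel (s i * s i) 1
| dBMW_s_far (i j : 'I_n.-1) of far i j : dBMW_rel (s i * s j) (s j * s i)
| dBMW_braid (i j : 'I_n.-1) of j = i.+1 :> nat :
    dBMW_rel (s i * s j * s i) (s j * s i * s j)
| dBMW_sy_comm (i : 'I_n.-1) (k : 'I_n.-1.+1) of k != lo i & k != hi i :
    dBMW_rel (s i * y k) (y k * s i)
| dBMW_ee (i : 'I_n.-1) : dBMW_rel (e i * e i) (omega 0%N *: e i)
| dBMW_eye (i : 'I_n.-1) (a : nat) of i = 0%N :> nat & (0 < a)%N :
    dBMW_rel (e i * y ord0 ^+ a * e i) (omega a *: e i)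
| dBMW_se_far (i j : 'I_n.-1) of far i j : dBMW_rel (s i * e j) (e j * s i)
| dBMW_ee_far (i j : 'I_n.-1) of far i j : dBMW_rel (e i * e j) (e j * e i)
| dBMW_ey_comm (i : 'I_n.-1) (k : 'I_n.-1.+1) of k != lo i & k != hi i :
    dBMW_rel (e i * y k) (y k * e i)
| dBMW_yy (k l : 'I_n.-1.+1) : dBMW_rel (y k * y l) (y l * y k)
| dBMW_es (i : 'I_n.-1) : dBMW_rel (e i * s i) (e i)
| dBMW_se (i : 'I_n.-1) : dBMW_rel (s i * e i) (e i)
| dBMW_see (i j : 'I_n.-1) of j = i.+1 :> nat :
    dBMW_rel (s i * e j * e i) (s j * e i)
| dBMW_ees (i j : 'I_n.-1) of j = i.+1 :> nat :
    dBMW_rel (e i * e j * s i) (e i * s j)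
| dBMW_ees' (i j : 'I_n.-1) of j = i.+1 :> nat :
    dBMW_rel (e j * e i * s j) (e j * s i)
| dBMW_see' (i j : 'I_n.-1) of j = i.+1 :> nat :
    dBMW_rel (s j * e i * e j) (s i * e j)
| dBMW_eee (i j : 'I_n.-1) of j = i.+1 :> nat :
    dBMW_rel (e j * e i * e j) (e j)
| dBMW_eee' (i j : 'I_n.-1) of j = i.+1 :> nat :
    dBMW_rel (e i * e j * e i) (e i)
| dBMW_sy (i : 'I_n.-1) : dBMW_rel (s i * y (lo i) - y (hi i) * s i) (e i - 1)
| dBMW_ys (i : 'I_n.-1) : dBMW_rel (y (lo i) * s i - s i * y (hi i)) (e i - 1)
| dBMW_eyy (i : 'I_n.-1) : dBMW_rel (e i * (y (lo i) + y (hi i))) 0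
| dBMW_yye (i : 'I_n.-1) : dBMW_rel ((y (lo i) + y (hi i)) * e i) 0.

Definition affine_dBMW := quot_algebra dBMW_rel.

(* The quotient of the affine algebra by the cyclotomic relation is presented by
   adding that relation; the number r of parameters is size u. *)
Inductive cyc_dBMW_rel (u : seq S) : F -> F -> Prop :=
| cyc_dBMW_affine a b of dBMW_rel a b : cyc_dBMW_rel u a b
| cyc_dBMW_cyclotomic : cyc_dBMW_rel u (\prod_(a <- u) (y ord0 - a%:A)) 0.

Definition cyc_dBMW (u : seq S) := quot_algebra (cyc_dBMW_rel u).

Definition dBMW_s u i : cyc_dBMW u := to_quot _ (s i).
Definition dBMW_e u i : cyc_dBMW u := to_quot _ (e i).
Definition dBMW_y u k : cyc_dBMW u := to_quot _ (y k).

End Degenerate.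

Arguments dBMW_s n {S} omega u i.
Arguments dBMW_e n {S} omega u i.
Arguments dBMW_y n {S} omega u k.

Section NonDegenerate.
Variables (n : nat) (S : comUnitRingType) (rho q : S) (omega : nat -> S).

(* The two copies of unit carry y_1 and y_1^{-1}. *)
Definition BMW_gen : choiceType :=
  ('I_n.-1 + 'I_n.-1 + 'I_n.-1 + unit + unit)%type.

Local Notation F := (free_algebra S BMW_gen).
Local Notation g i := (free_gen S (inl (inl (inl (inl i))) : BMW_gen)).
Local Notation gi i := (free_gen S (inl (inl (inl (inr i))) : BMW_gen)).
Local Notation e i := (free_gen S (inl (inl (inr i)) : BMW_gen)).
Local Notation y := (free_gen S (inl (inr tt) : BMW_gen)).
Local Notation yi := (free_gen S (inr tt : BMW_gen)).

(* gi i and yi are the generators g_i^{-1} and y_1^{-1}; they are two-sided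
   inverses by the first four relations. *)
Inductive BMW_rel : F -> F -> Prop :=
| BMW_ggi (i : 'I_n.-1) : BMW_rel (g i * gi i) 1
| BMW_gig (i : 'I_n.-1) : BMW_rel (gi i * g i) 1
| BMW_yyi : BMW_rel (y * yi) 1
| BMW_yiy : BMW_rel (yi * y) 1
| BMW_braid (i j : 'I_n.-1) of j = i.+1 :> nat :
    BMW_rel (g i * g j * g i) (g j * g i * g j)
| BMW_g_far (i j : 'I_n.-1) of far i j : BMW_rel (g i * g j) (g j * g i)
| BMW_ygyg (i : 'I_n.-1) of i = 0%N :> nat :
    BMW_rel (y * g i * y * g i) (g i * y * g i * y)
| BMW_yg_comm (i : 'I_n.-1) of (0 < i)%N : BMW_rel (y * g i) (g i * y)
| BMW_ee (i : 'I_n.-1) : BMW_rel (e i * e i) (omega 0%N *: e i)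
| BMW_eye (i : 'I_n.-1) (a : nat) of i = 0%N :> nat & (0 < a)%N :
    BMW_rel (e i * y ^+ a * e i) (omega a *: e i)
| BMW_ge_far (i j : 'I_n.-1) of far i j : BMW_rel (g i * e j) (e j * g i)
| BMW_ee_far (i j : 'I_n.-1) of far i j : BMW_rel (e i * e j) (e j * e i)
| BMW_ye_comm (i : 'I_n.-1) of (0 < i)%N : BMW_rel (y * e i) (e i * y)
| BMW_ge (i : 'I_n.-1) : BMW_rel (g i * e i) (rho^-1 *: e i)
| BMW_eg (i : 'I_n.-1) : BMW_rel (e i * g i) (rho^-1 *: e i)
| BMW_ege (i j : 'I_n.-1) of adjacent i j :
    BMW_rel (e i * g j * e i) (rho *: e i)
| BMW_eee (i j : 'I_n.-1) of adjacent i j : BMW_rel (e i * e j * e i) (e i)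
| BMW_gge (i j : 'I_n.-1) of adjacent i j :
    BMW_rel (g i * g j * e i) (e j * e i)
| BMW_egg (i j : 'I_n.-1) of adjacent i j :
    BMW_rel (e i * g j * g i) (e i * e j)
| BMW_skein (i : 'I_n.-1) : BMW_rel (g i - gi i) ((q - q^-1) *: (1 - e i))
| BMW_eygyg (i : 'I_n.-1) of i = 0%N :> nat :
    BMW_rel (e i * y * g i * y * g i) (e i)
| BMW_gygye (i : 'I_n.-1) of i = 0%N :> nat :
    BMW_rel (g i * y * g i * y * e i) (e i).

Definition affine_BMW := quot_algebra BMW_rel.

Inductive cyc_BMW_rel (u : seq S) : F -> F -> Prop :=
| cyc_BMW_affine a b of BMW_rel a b : cyc_BMW_rel u a b
| cyc_BMW_cyclotomic : cyc_BMW_rel u (\prod_(a <- u) (y - a%:A)) 0.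

Definition cyc_BMW (u : seq S) := quot_algebra (cyc_BMW_rel u).

Definition BMW_g u i : cyc_BMW u := to_quot _ (g i).
Definition BMW_ginv u i : cyc_BMW u := to_quot _ (gi i).
Definition BMW_e u i : cyc_BMW u := to_quot _ (e i).
Definition BMW_y u : cyc_BMW u := to_quot _ y.
Definition BMW_yinv u : cyc_BMW u := to_quot _ yi.

End NonDegenerate.

Arguments BMW_g n {S} rho q omega u i.
Arguments BMW_ginv n {S} rho q omega u i.
Arguments BMW_e n {S} rho q omega u i.
Arguments BMW_y n {S} rho q omega u.
Arguments BMW_yinv n {S} rho q omega u.

Definition left_ideal (A : pzRingType) (x : A) : A -> Prop :=
  fun z => exists a, z = a * x.

Section LinearAlgebra.
Variables (S : comNzRingType) (V : lmodType S).

(* The definition of torsion freeness used for an integral domain S. *)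
Definition torsion_free (M : V -> Prop) : Prop :=
  forall (c : S) (v : V), M v -> c *: v = 0 -> c = 0 \/ v = 0.

Definition lin_indep m (v : 'I_m -> V) : Prop :=
  forall c : 'I_m -> S, \sum_(i < m) c i *: v i = 0 -> forall i, c i = 0.

End LinearAlgebra.

Section DegenerateParameters.
Variables (S : comNzRingType) (omega : nat -> S) (u : seq S).

(* e_1 and y_1 in the cyclotomic algebra with n = 2. *)
Definition dBMW2_e1 : cyc_dBMW 2 omega u := dBMW_e 2 omega u ord0.
Definition dBMW2_y1 : cyc_dBMW 2 omega u := dBMW_y 2 omega u ord0.

Definition dBMW_indep (d : nat) : Prop :=
  lin_indep (fun j : 'I_d => dBMW2_y1 ^+ j * dBMW2_e1).

Definition dBMW_semi_admissible (d : nat) : Prop :=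
  [/\ (0 < d < size u)%N, dBMW_indep d & ~ dBMW_indep d.+1].

Definition dBMW_admissible : Prop := dBMW_indep (size u).

End DegenerateParameters.

Section NonDegenerateParameters.
Variables (S : comUnitRingType) (rho q : S) (omega : nat -> S) (u : seq S).

Definition BMW_parameters : Prop :=
  [/\ rho \is a GRing.unit, q \is a GRing.unit,
      {in u, forall a, a \is a GRing.unit}
    & rho^-1 - rho = (q^-1 - q) * (omega 0%N - 1)].

Definition BMW2_e1 : cyc_BMW 2 rho q omega u := BMW_e 2 rho q omega u ord0.
Definition BMW2_y1 : cyc_BMW 2 rho q omega u := BMW_y 2 rho q omega u.

Definition BMW_indep (d : nat) : Prop :=
  lin_indep (fun j : 'I_d => BMW2_y1 ^+ j * BMW2_e1).

Definition BMW_semi_admissible (d : nat) : Prop :=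
  [/\ (0 < d < size u)%N, BMW_indep d & ~ BMW_indep d.+1].

Definition BMW_admissible : Prop := BMW_indep (size u).

End NonDegenerateParameters.

(* Main.v *)
Require Import Defs.
From HB Require Import structures.
From mathcomp Require Import all_boot all_order all_algebra.
From mathcomp Require Import boolp monalg ring.

Set Implicit Arguments.
Unset Strict Implicit.
Unset Printing Implicit Defensive.

Import GRing.Theory.
Local Open Scope ring_scope.

(** Multiplying p0(y) e = 0 on the left by e y^l turns each y^(j+l) into
    omega_(j+l), which is the recurrence, because e is not a torsion element.

    For the linear independence, let V be the S-module spanned by the y^j e in
    the algebra A with all the parameters.  It is a left ideal, because the
    relations move every generator past the powers of y (dBMW2_descent,
    BMW2_descent).  Since p0(y) e = 0 it is already spanned by e, ..., y^(d-1) e,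
    so by hypothesis it is free of rank d and the generators act on it by
    matrices.  As p0(y) commutes with y, it kills all of V; hence V is a module
    over the algebra B whose only parameters are the roots u_1, ..., u_d of p0.

    Suppose that sum_j c_j y^j e = 0 in B.  Applied to the vector y^k e of V this
    says omega_k sum_j c_j y^j e = 0, that is omega_k c_j = 0 for all j, and the
    c_j vanish as soon as some omega_k is not 0.

    If all the omega_k are 0, then e acts on V by 0 and V carries no information
    about the c_j.  A larger B-module W is needed, in which e is visible.  Adjoin
    to V a vector w with y w = u_1 w and e w = e.  With t = g^-1 w (t = s w in the
    degenerate case) the resulting module has the elements
        a + f(y) t + g h(y) t,    a in V and f, h polynomials modulo p0,
    and the relations dictate the action of the generators on the triples
    (a, f, h) of elements of V = S[y]/(p0).  Written as 3 x 3 matrices over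
    End(V), this action involves only the operators of V and the projection P
    that sends f(y) e to f(u_1) e.  These matrices satisfy the relations
    (dblock_relations, block_relations); the cyclotomic one holds because
    prod_(j > 1) (y - u_j) kills f(y) e - f(u_1) e, whose polynomial has the
    root u_1 (eigenprojection, triangular_cyclotomic).  In W the sum above sends
    a vector to a unit multiple of sum_j c_j y^j e in V, so that all the c_j are
    0. *)

(** * Evaluating presented algebras *)

Section FreeAlgebraUniversal.
Variables (S : comNzRingType) (X : choiceType) (B : nzRingType).
Variables (iota : {rmorphism S -> B}) (T : X -> B).
Hypothesis iotaC : forall c b, GRing.comm (iota c) b.

Let word_eval (m : {fmonom X}) : B := \prod_(i <- (m : seq X)) T i.

Let word_eval_mmorphism : mmorphism word_eval.
Proof.
by split=> [m1 m2|]; rewrite /word_eval ?fmM ?big_cat // fm1 big_nil.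
Qed.

(** Word evaluation is multiplicative on monomials; its linear extension is so
    because the scalars become central in B.  B is a ring with a central map from S,
    and not an S-algebra, to cover the matrices over a noncommutative S-algebra. *)
Lemma free_algebra_universal :
  exists f : {rmorphism free_algebra S X -> B},
    (forall i, f (free_gen S i) = T i) /\
    (forall c x, f (c *: x) = iota c * f x).
Proof.
pose hM := isMultiplicative.Build _ _ word_eval word_eval_mmorphism.
pose h : {mmorphism {fmonom X} -> B} := HB.pack word_eval hM.
have mM : GRing.monoid_morphism (mmap iota h).
  have [|mM m1] := @commr_mmap_is_multiplicative _ _ _ iota h; last by split.
  by move=> g m m'; apply: iotaC.
pose fM := GRing.isMonoidMorphism.Build _ _ _ mM.
pose f : {rmorphism free_algebra S X -> B} := HB.pack (mmap iota h) fM.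
exists f; split=> [i|c x]; last exact: mmapZ.
have -> : f (free_gen S i) = mmap iota h << fmu i >> by [].
by rewrite mmapU /= (rmorph1 iota) mul1r /word_eval fmU big_seq1.
Qed.

End FreeAlgebraUniversal.

(** The kernel of f is a two-sided ideal that contains the differences of related
    elements, hence the ideal they generate. *)
Lemma to_quot_eval (S : comNzRingType) (A : algType S) (R : A -> A -> Prop)
    (B : pzRingType) (f : {rmorphism A -> B}) :
  (forall x y, R x y -> f x = f y) ->
  forall x y, to_quot R x = to_quot R y -> f x = f y.
Proof.
move=> fR x y /to_quotP Ixy; apply/eqP; rewrite -subr_eq0 -rmorphB; apply/eqP.
elim: Ixy => {x y} [x y /fR fxy||x y _ fx _ fy|a b x _ fx].
- by rewrite rmorphB fxy subrr.
- exact: rmorph0.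
- by rewrite rmorphD fx fy addr0.
- by rewrite !rmorphM fx mulr0 mul0r.
Qed.

Lemma to_quot_sum (S : comNzRingType) (F : algType S) (R : F -> F -> Prop)
    d (c : 'I_d -> S) (x : 'I_d -> F) :
  to_quot R (\sum_i c i *: x i) = \sum_i c i *: to_quot R (x i).
Proof.
elim/big_rec2: _ => [|i z t _ <-]; first exact: to_quot0.
by rewrite to_quotD to_quotZ.
Qed.

Lemma to_quotX (S : comNzRingType) (F : algType S) (R : F -> F -> Prop) (x : F) k :
  to_quot R (x ^+ k) = to_quot R x ^+ k.
Proof.
by elim: k => [|k IH]; [exact: to_quot1 | rewrite !exprS to_quotM IH].
Qed.

Section QuotientRelations.
Variables (S : comNzRingType) (F : algType S) (R : F -> F -> Prop).
Local Notation quot := (to_quot R).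

Lemma to_quot_rel x z : R x z -> quot x = quot z.
Proof. by move=> xz; apply/to_quotP/ideal_gen_rel. Qed.

Lemma to_quot_scal c x : (c *: (1 : quot_algebra R)) * quot x = quot (c *: x).
Proof. by rewrite -quot_scalerAl mul1r to_quotZ. Qed.

Lemma to_quot_cyclotomic (w : seq S) (y : F) : R (\prod_(a <- w) (y - a%:A)) 0 ->
  \prod_(a <- w) (quot y - a *: (1 : quot_algebra R)) = 0.
Proof.
move=> cyc; rewrite -to_quot0 -(to_quot_rel cyc).
elim/big_rec2: _ => [|a z t _ ->]; first exact: to_quot1.
by rewrite to_quotM to_quotD to_quotN to_quotZ to_quot1.
Qed.

End QuotientRelations.

(** * The relations on two strands *)

(** For n = 2 there is one index i, so every relation that involves two distinct
    indices, or an index of y away from i and i + 1, is void; these are the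
    others.  The exponent a = 0 covers the relation for the square of e. *)
Record dBMW2_relations (S : comNzRingType) (B : pzRingType) (iota : S -> B)
    (omega : nat -> S) (w : seq S) (s e y y' : B) : Prop := {
  dBMW2_ss : s * s = 1;
  dBMW2_eye : forall a, e * y ^+ a * e = iota (omega a) * e;
  dBMW2_yy : y * y' = y' * y;
  dBMW2_es : e * s = e;
  dBMW2_se : s * e = e;
  dBMW2_sy : s * y - y' * s = e - 1;
  dBMW2_ys : y * s - s * y' = e - 1;
  dBMW2_eyy : e * (y + y') = 0;
  dBMW2_yye : (y + y') * e = 0;
  dBMW2_cyclotomic : \prod_(a <- w) (y - iota a) = 0
}.

Record BMW2_relations (S : comUnitRingType) (B : pzRingType) (iota : S -> B)
    (rho q : S) (omega : nat -> S) (w : seq S) (g gi e y yi : B) : Prop := {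
  BMW2_ggi : g * gi = 1;
  BMW2_gig : gi * g = 1;
  BMW2_yyi : y * yi = 1;
  BMW2_yiy : yi * y = 1;
  BMW2_ygyg : y * g * y * g = g * y * g * y;
  BMW2_eye : forall a, e * y ^+ a * e = iota (omega a) * e;
  BMW2_ge : g * e = iota rho^-1 * e;
  BMW2_eg : e * g = iota rho^-1 * e;
  BMW2_skein : g - gi = iota (q - q^-1) * (1 - e);
  BMW2_eygyg : e * y * g * y * g = e;
  BMW2_gygye : g * y * g * y * e = e;
  BMW2_cyclotomic : \prod_(a <- w) (y - iota a) = 0
}.

Lemma to_quot_dBMW2_relations (S : comNzRingType) (F : algType S)
    (R : F -> F -> Prop) (omega : nat -> S) (w : seq S) (s e y y' : F) :
  R (s * s) 1 -> R (e * e) (omega 0%N *: e) ->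
  (forall a, (0 < a)%N -> R (e * y ^+ a * e) (omega a *: e)) ->
  R (y * y') (y' * y) -> R (e * s) e -> R (s * e) e ->
  R (s * y - y' * s) (e - 1) -> R (y * s - s * y') (e - 1) ->
  R (e * (y + y')) 0 -> R ((y + y') * e) 0 ->
  R (\prod_(a <- w) (y - a%:A)) 0 ->
  dBMW2_relations (fun c => c *: (1 : quot_algebra R)) omega w
    (to_quot R s) (to_quot R e) (to_quot R y) (to_quot R y').
Proof.
move=> ss ee eye yy es se sy ys eyy yye cyc; split.
- by rewrite -to_quotM (to_quot_rel ss) to_quot1.
- case=> [|a]; rewrite to_quot_scal.
    by rewrite expr0 mulr1 -to_quotM (to_quot_rel ee).
  by rewrite -to_quotX -(to_quotM _ e) -to_quotM (to_quot_rel (eye _ _)).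
- by rewrite -to_quotM (to_quot_rel yy) to_quotM.
- by rewrite -to_quotM (to_quot_rel es).
- by rewrite -to_quotM (to_quot_rel se).
- rewrite -(to_quotM _ s) -(to_quotM _ y') -to_quot1 -!to_quotN -!to_quotD.
  by rewrite (to_quot_rel sy).
- rewrite -(to_quotM _ y) -(to_quotM _ s) -to_quot1 -!to_quotN -!to_quotD.
  by rewrite (to_quot_rel ys).
- by rewrite -to_quotD -to_quotM (to_quot_rel eyy) to_quot0.
- by rewrite -to_quotD -to_quotM (to_quot_rel yye) to_quot0.
- exact: to_quot_cyclotomic.
Qed.

Lemma to_quot_BMW2_relations (S : comUnitRingType) (F : algType S)
    (R : F -> F -> Prop) (rho q : S) (omega : nat -> S) (w : seq S)
    (g gi e y yi : F) :
  R (g * gi) 1 -> R (gi * g) 1 -> R (y * yi) 1 -> R (yi * y) 1 ->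
  R (y * g * y * g) (g * y * g * y) ->
  R (e * e) (omega 0%N *: e) ->
  (forall a, (0 < a)%N -> R (e * y ^+ a * e) (omega a *: e)) ->
  R (g * e) (rho^-1 *: e) -> R (e * g) (rho^-1 *: e) ->
  R (g - gi) ((q - q^-1) *: (1 - e)) ->
  R (e * y * g * y * g) e -> R (g * y * g * y * e) e ->
  R (\prod_(a <- w) (y - a%:A)) 0 ->
  BMW2_relations (fun c => c *: (1 : quot_algebra R)) rho q omega w
    (to_quot R g) (to_quot R gi) (to_quot R e) (to_quot R y) (to_quot R yi).
Proof.
move=> ggi gig yyi yiy ygyg ee eye ge eg skein eygyg gygye cyc; split.
- by rewrite -to_quotM (to_quot_rel ggi) to_quot1.
- by rewrite -to_quotM (to_quot_rel gig) to_quot1.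
- by rewrite -to_quotM (to_quot_rel yyi) to_quot1.
- by rewrite -to_quotM (to_quot_rel yiy) to_quot1.
- by have := to_quot_rel ygyg; rewrite !to_quotM.
- case=> [|a]; rewrite to_quot_scal.
    by rewrite expr0 mulr1 -to_quotM (to_quot_rel ee).
  by rewrite -to_quotX -(to_quotM _ e) -to_quotM (to_quot_rel (eye _ _)).
- by rewrite -to_quotM (to_quot_rel ge) to_quot_scal.
- by rewrite -to_quotM (to_quot_rel eg) to_quot_scal.
- by rewrite -to_quot1 -!to_quotN -!to_quotD to_quot_scal (to_quot_rel skein).
- by have := to_quot_rel eygyg; rewrite !to_quotM.
- by have := to_quot_rel gygye; rewrite !to_quotM.
- exact: to_quot_cyclotomic.
Qed.

Section DegenerateRelations.
Variables (S : comNzRingType) (omega : nat -> S) (v : seq S).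
Local Notation A := (cyc_dBMW 2 omega v).
Local Notation e := (dBMW2_e1 omega v).
Local Notation y := (dBMW2_y1 omega v).
Let s : A := dBMW_s 2 omega v ord0.
Let y' : A := dBMW_y 2 omega v (hi (ord0 : 'I_1)).

Lemma cyc_dBMW2_relations :
  dBMW2_relations (fun c => c *: (1 : A)) omega v s e y y'.
Proof.
have lo0 : lo ord0 = ord0 :> 'I_2 by apply: val_inj.
have sy := @dBMW_sy 2 _ omega ord0; have ys := @dBMW_ys 2 _ omega ord0.
have eyy := @dBMW_eyy 2 _ omega ord0; have yye := @dBMW_yye 2 _ omega ord0.
rewrite lo0 in sy ys eyy yye.
apply: to_quot_dBMW2_relations; last exact: cyc_dBMW_cyclotomic.
- exact/cyc_dBMW_affine/dBMW_ss.
- exact/cyc_dBMW_affine/dBMW_ee.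
- by move=> a a_gt0; apply/cyc_dBMW_affine/dBMW_eye.
- exact/cyc_dBMW_affine/dBMW_yy.
- exact/cyc_dBMW_affine/dBMW_es.
- exact/cyc_dBMW_affine/dBMW_se.
- exact: cyc_dBMW_affine sy.
- exact: cyc_dBMW_affine ys.
- exact: cyc_dBMW_affine eyy.
- exact: cyc_dBMW_affine yye.
Qed.
End DegenerateRelations.

Section NonDegenerateRelations.
Variables (S : comUnitRingType) (rho q : S) (omega : nat -> S) (v : seq S).
Local Notation A := (cyc_BMW 2 rho q omega v).

Lemma cyc_BMW2_relations :
  BMW2_relations (fun c => c *: (1 : A)) rho q omega v
    (BMW_g 2 rho q omega v ord0) (BMW_ginv 2 rho q omega v ord0)
    (BMW2_e1 rho q omega v) (BMW2_y1 rho q omega v) (BMW_yinv 2 rho q omega v).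
Proof.
apply: to_quot_BMW2_relations; last exact: cyc_BMW_cyclotomic.
- exact/cyc_BMW_affine/BMW_ggi.
- exact/cyc_BMW_affine/BMW_gig.
- exact/cyc_BMW_affine/BMW_yyi.
- exact/cyc_BMW_affine/BMW_yiy.
- exact/cyc_BMW_affine/BMW_ygyg.
- exact/cyc_BMW_affine/BMW_ee.
- by move=> a a_gt0; apply/cyc_BMW_affine/BMW_eye.
- exact/cyc_BMW_affine/BMW_ge.
- exact/cyc_BMW_affine/BMW_eg.
- exact/cyc_BMW_affine/BMW_skein.
- exact/cyc_BMW_affine/BMW_eygyg.
- exact/cyc_BMW_affine/BMW_gygye.
Qed.
End NonDegenerateRelations.

Lemma lo_or_hi (i : 'I_1) (k : 'I_2) : k = lo i \/ k = hi i.
Proof.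
rewrite [i]ord1; case: k => [[|[|k]] kP] //; [left|right]; exact: val_inj.
Qed.

Lemma far_ord1F (i j : 'I_1) : ~ far i j.
Proof. by rewrite !ord1. Qed.

Lemma adjacent_ord1F (i j : 'I_1) : ~ adjacent i j.
Proof. by rewrite !ord1. Qed.

Lemma succ_ord1F (i j : 'I_1) : j <> i.+1 :> nat.
Proof. by rewrite !ord1. Qed.

Lemma pos_ord1F (i : 'I_1) : ~ (0 < i)%N.
Proof. by rewrite ord1. Qed.

Section Evaluation.
Variables (S : comNzRingType) (B : nzRingType) (iota : {rmorphism S -> B}).
Hypothesis iotaC : forall c b, GRing.comm (iota c) b.

Lemma dBMW2_eval (omega : nat -> S) (w : seq S) (s e y y' : B) :
  dBMW2_relations iota omega w s e y y' ->
  forall d (c : 'I_d -> S),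
  \sum_j c j *: (dBMW2_y1 omega w ^+ j * dBMW2_e1 omega w) = 0 ->
  \sum_j iota (c j) * (y ^+ j * e) = 0.
Proof.
case=> ss eye yy es se sy ys eyy yye cyc d c.
pose T (x : dBMW_gen 2) : B :=
  match x with inl (inl _) => s | inl (inr _) => e
  | inr k => if k == ord0 then y else y' end.
have [f [fT fZ]] := free_algebra_universal T iotaC.
have fS i : f (free_gen S (inl (inl i) : dBMW_gen 2)) = s by rewrite fT.
have fE i : f (free_gen S (inl (inr i) : dBMW_gen 2)) = e by rewrite fT.
have fY k : f (free_gen S (inr k : dBMW_gen 2)) = if k == ord0 then y else y'.
  by rewrite fT.
have lo0 (i : 'I_1) : (lo i == ord0) = true by rewrite ord1.
have hi0 (i : 'I_1) : (hi i == ord0) = false by rewrite ord1.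
have fM a b : f (a * b) = f a * f b by exact: rmorphM.
have fB a b : f (a - b) = f a - f b by exact: rmorphB.
have fD a b : f (a + b) = f a + f b by exact: rmorphD.
have f1 : f 1 = 1 by exact: rmorph1.
(* Whole left-hand sides are rewritten at once: comparing a product with a
   difference would unfold the arithmetic of the free algebra. *)
have fMB a b a' b' : f (a * b - a' * b') = f a * f b - f a' * f b'.
  by rewrite -!fM -fB.
have fB1 a : f (a - 1) = f a - 1 by rewrite -f1 -fB.
have fMX a b k a' : f (a * b ^+ k * a') = f a * f b ^+ k * f a'.
  by rewrite -(rmorphXn f) -!fM.
have fA a : f a%:A = iota a by rewrite fZ f1 mulr1.
have fR a b : dBMW_rel omega a b -> f a = f b.
  case=> {a b}.
  - by move=> i; rewrite fM f1 fS ss.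
  - move=> i j /far_ord1F [].
  - move=> i j /succ_ord1F [].
  - move=> i k /eqP kl /eqP kh; have [/kl|/kh] := lo_or_hi i k; exact: False_ind.
  - by move=> i; rewrite fM fZ fE -(eye 0%N) expr0 mulr1.
  - by move=> i a _ _; rewrite fMX fZ fE fY /= eye.
  - move=> i j /far_ord1F [].
  - move=> i j /far_ord1F [].
  - move=> i k /eqP kl /eqP kh; have [/kl|/kh] := lo_or_hi i k; exact: False_ind.
  - by move=> k l; apply: etrans (etrans (fM _ _) _) (esym (fM _ _));
    rewrite !fY; case: eqP; case: eqP.
  - by move=> i; rewrite fM fS fE es.
  - by move=> i; rewrite fM fS fE se.
  - move=> i j /succ_ord1F [].
  - move=> i j /succ_ord1F [].
  - move=> i j /succ_ord1F [].
  - move=> i j /succ_ord1F [].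
  - move=> i j /succ_ord1F [].
  - move=> i j /succ_ord1F [].
  - by move=> i; rewrite fMB [RHS]fB1 fS fE !fY lo0 hi0 sy.
  - by move=> i; rewrite fMB [RHS]fB1 fS fE !fY lo0 hi0 ys.
  - by move=> i; rewrite fM fD rmorph0 fE !fY lo0 hi0 eyy.
  - by move=> i; rewrite fM fD rmorph0 fE !fY lo0 hi0 yye.
have fR' a b : cyc_dBMW_rel omega w a b -> f a = f b.
  case=> [a' b'|]; first exact: fR.
  rewrite rmorph0 rmorph_prod -[RHS]cyc; apply: eq_bigr => t _.
  by rewrite fB fA fY.
move=> c0; pose z := \sum_j c j *: (free_gen S (inr ord0 : dBMW_gen 2) ^+ j *
  free_gen S (inl (inr ord0) : dBMW_gen 2)).
rewrite -[RHS](rmorph0 f) -(to_quot_eval fR' (x := z)).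
  by rewrite rmorph_sum; apply: eq_bigr => j _; rewrite fZ rmorphM rmorphXn /= fY fE.
rewrite to_quot0 -[RHS]c0 to_quot_sum; apply: eq_bigr => j _.
by rewrite to_quotM to_quotX.
Qed.
End Evaluation.

Section NonDegenerateEvaluation.
Variables (S : comUnitRingType) (B : nzRingType) (iota : {rmorphism S -> B}).
Hypothesis iotaC : forall c b, GRing.comm (iota c) b.

Lemma BMW2_eval (rho q : S) (omega : nat -> S) (w : seq S) (g gi e y yi : B) :
  BMW2_relations iota rho q omega w g gi e y yi ->
  forall d (c : 'I_d -> S),
  \sum_j c j *: (BMW2_y1 rho q omega w ^+ j * BMW2_e1 rho q omega w) = 0 ->
  \sum_j iota (c j) * (y ^+ j * e) = 0.
Proof.
case=> ggi gig yyi yiy ygyg eye ge eg skein eygyg gygye cyc d c.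
pose T (x : BMW_gen 2) : B :=
  match x with inl (inl (inl (inl _))) => g | inl (inl (inl (inr _))) => gi
  | inl (inl (inr _)) => e | inl (inr _) => y | inr _ => yi end.
have [f [fT fZ]] := free_algebra_universal T iotaC.
have fG i : f (free_gen S (inl (inl (inl (inl i))) : BMW_gen 2)) = g by rewrite fT.
have fGi i : f (free_gen S (inl (inl (inl (inr i))) : BMW_gen 2)) = gi by rewrite fT.
have fE i : f (free_gen S (inl (inl (inr i)) : BMW_gen 2)) = e by rewrite fT.
have fY i : f (free_gen S (inl (inr i) : BMW_gen 2)) = y by rewrite fT.
have fYi i : f (free_gen S (inr i : BMW_gen 2)) = yi by rewrite fT.
have fM a b : f (a * b) = f a * f b by exact: rmorphM.
have fB a b : f (a - b) = f a - f b by exact: rmorphB.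
have f1 : f 1 = 1 by exact: rmorph1.
have fMX a b k a' : f (a * b ^+ k * a') = f a * f b ^+ k * f a'.
  by rewrite -(rmorphXn f) -!fM.
have fM4 a b a' b' : f (a * b * a' * b') = f a * f b * f a' * f b'.
  by rewrite -!fM.
have fM5 a b a' b' t : f (a * b * a' * b' * t) = f a * f b * f a' * f b' * f t.
  by rewrite -!fM.
have fZB1 k a : f (k *: (1 - a)) = iota k * (1 - f a).
  by rewrite fZ -f1 -fB.
have fA a : f a%:A = iota a by rewrite fZ f1 mulr1.
have fR a b : BMW_rel rho q omega a b -> f a = f b.
  case=> {a b}; try first [move=> i j /far_ord1F [] | move=> i j /adjacent_ord1F []
    | move=> i j /succ_ord1F [] | move=> i /pos_ord1F []].
  - by move=> i; rewrite fM f1 fG fGi ggi.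
  - by move=> i; rewrite fM f1 fG fGi gig.
  - by rewrite fM f1 fY fYi yyi.
  - by rewrite fM f1 fY fYi yiy.
  - by move=> i _; apply: etrans (etrans (fM4 _ _ _ _) _) (esym (fM4 _ _ _ _));
    rewrite fG fY ygyg.
  - by move=> i; rewrite fM fZ fE -(eye 0%N) expr0 mulr1.
  - by move=> i a _ _; rewrite fMX fZ fE fY /= eye.
  - by move=> i; rewrite fM fZ fG fE ge.
  - by move=> i; rewrite fM fZ fG fE eg.
  - by move=> i; rewrite fB [RHS]fZB1 fG fGi fE skein.
  - by move=> i _; rewrite fM5 fG fE fY eygyg.
  - by move=> i _; rewrite fM5 fG fE fY gygye.
have fR' a b : cyc_BMW_rel rho q omega w a b -> f a = f b.
  case=> [a' b'|]; first exact: fR.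
  rewrite rmorph0 rmorph_prod -[RHS]cyc; apply: eq_bigr => t _.
  by rewrite fB fA fY.
move=> c0; pose z := \sum_j c j *: (free_gen S (inl (inr tt) : BMW_gen 2) ^+ j *
  free_gen S (inl (inl (inr ord0)) : BMW_gen 2)).
rewrite -[RHS](rmorph0 f) -(to_quot_eval fR' (x := z)).
  by rewrite rmorph_sum; apply: eq_bigr => j _; rewrite fZ rmorphM rmorphXn /= fY fE.
rewrite to_quot0 -[RHS]c0 to_quot_sum; apply: eq_bigr => j _.
by rewrite to_quotM to_quotX.
Qed.
End NonDegenerateEvaluation.

(** * Three by three block matrices *)

Section Matrix3.
Variable D : nzRingType.

Definition mx3 (a b c a' b' c' a'' b'' c'' : D) : 'M[D]_3 :=
  \matrix_(i < 3, j < 3)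
    nth 0 (nth [::] [:: [:: a; b; c]; [:: a'; b'; c']; [:: a''; b''; c'']] i) j.

Lemma eq_mx3 a b c a' b' c' a'' b'' c'' x y z x' y' z' x'' y'' z'' :
  a = x -> b = y -> c = z -> a' = x' -> b' = y' -> c' = z' ->
  a'' = x'' -> b'' = y'' -> c'' = z'' ->
  mx3 a b c a' b' c' a'' b'' c'' = mx3 x y z x' y' z' x'' y'' z''.
Proof. by move=> -> -> -> -> -> -> -> -> ->. Qed.

Lemma mx3_mul a b c a' b' c' a'' b'' c'' x y z x' y' z' x'' y'' z'' :
  mx3 a b c a' b' c' a'' b'' c'' * mx3 x y z x' y' z' x'' y'' z'' =
  mx3 (a * x + b * x' + c * x'') (a * y + b * y' + c * y'')
      (a * z + b * z' + c * z'')
      (a' * x + b' * x' + c' * x'') (a' * y + b' * y' + c' * y'')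
      (a' * z + b' * z' + c' * z'')
      (a'' * x + b'' * x' + c'' * x'') (a'' * y + b'' * y' + c'' * y'')
      (a'' * z + b'' * z' + c'' * z'').
Proof.
apply/matrixP=> i j; rewrite !mxE !big_ord_recl big_ord0 addr0 !mxE /= addrA.
by case: i j => [[|[|[|?]]] //= ?] [[|[|[|?]]] //= ?].
Qed.

Lemma mx3_add a b c a' b' c' a'' b'' c'' x y z x' y' z' x'' y'' z'' :
  mx3 a b c a' b' c' a'' b'' c'' + mx3 x y z x' y' z' x'' y'' z'' =
  mx3 (a + x) (b + y) (c + z) (a' + x') (b' + y') (c' + z')
      (a'' + x'') (b'' + y'') (c'' + z'').
Proof.
apply/matrixP=> i j; rewrite !mxE.
by case: i j => [[|[|[|?]]] //= ?] [[|[|[|?]]] //= ?].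
Qed.

Lemma mx3_opp a b c a' b' c' a'' b'' c'' :
  - mx3 a b c a' b' c' a'' b'' c'' =
  mx3 (- a) (- b) (- c) (- a') (- b') (- c') (- a'') (- b'') (- c'').
Proof.
apply/matrixP=> i j; rewrite !mxE.
by case: i j => [[|[|[|?]]] //= ?] [[|[|[|?]]] //= ?].
Qed.

Lemma mx3_scalar a : a%:M = mx3 a 0 0 0 a 0 0 0 a.
Proof.
apply/matrixP=> i j; rewrite !mxE.
by case: i j => [[|[|[|?]]] //= ?] [[|[|[|?]]] //= ?]; rewrite ?mulr1n ?mulr0n.
Qed.

Lemma mx3_0 : mx3 0 0 0 0 0 0 0 0 0 = 0.
Proof. by rewrite -mx3_scalar -scalemx1 scale0r. Qed.

Lemma mx3_1 : mx3 1 0 0 0 1 0 0 0 1 = 1.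
Proof. by rewrite -mx3_scalar. Qed.
End Matrix3.

Lemma alg_scalar_comm (S : comNzRingType) (D : algType S) (k : S) (b : D) :
  GRing.comm (in_alg D k) b.
Proof. by rewrite /GRing.comm /= mulr_algl mulr_algr. Qed.

Lemma scalar_block_comm (S : comNzRingType) (D : algType S) (k : S) (b : 'M[D]_3) :
  GRing.comm ((k%:A)%:M) b.
Proof.
rewrite /GRing.comm -[_ * b]/(_ *m b) -[b * _]/(b *m _).
apply/matrixP=> i j; rewrite mul_scalar_mx !mxE (bigD1 j) //= big1 => [|t tj].
  by rewrite mxE eqxx mulr1n addr0 mulr_algr mulr_algl.
by rewrite mxE (negPf tj) mulr0n mulr0.
Qed.

Definition mx3_simp := (mul0r, mulr0, mul1r, mulr1, add0r, addr0, subr0, oppr0).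

(** In prod_(b <- l) (y - b) * (y - u) the last row vanishes with y - u, and in the
    other rows the product has diagonal entries prod_(b <- u :: l) (Y - b) and
    entries prod_(b <- l) (Y - b) * C X in the last column. *)
Lemma triangular_cyclotomic (S : comNzRingType) (D : algType S)
    (Y C X X' : D) (u : S) (l : seq S) :
  \prod_(b <- l) (Y - b%:A) * C = 0 ->
  \prod_(b <- u :: l) (Y - b%:A) = 0 ->
  \prod_(b <- u :: l)
    (mx3 Y 0 (C * X) 0 Y (C * X') 0 0 u%:A - (b%:A)%:M) = 0.
Proof.
set y := mx3 _ _ _ _ _ _ _ _ _ => pC0 p0.
have [a [b [c pE]]] : exists a b c, \prod_(t <- l) (y - (t%:A)%:M) =
    mx3 (\prod_(t <- l) (Y - t%:A)) 0 a 0 (\prod_(t <- l) (Y - t%:A)) b 0 0 c.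
  elim: l {pC0 p0} => [|t l [a [b [c IHl]]]].
    by exists 0, 0, 1; rewrite !big_nil -mx3_scalar.
  rewrite !big_cons IHl mx3_scalar mx3_opp mx3_add mx3_mul !mx3_simp.
  by do 3!eexists.
have commp (R : nzRingType) (x : R) (f : S -> R) :
    (forall t z, GRing.comm z (f t)) ->
    (x - f u) * \prod_(t <- l) (x - f t) = \prod_(t <- l) (x - f t) * (x - f u).
  move=> fC; rewrite -/(GRing.comm _ _).
  elim: (l) => [|t k IHk]; first by rewrite big_nil; apply: commr1.
  rewrite big_cons; apply: commrM => //.
  apply: commrB; last exact: fC.
  by apply/commr_sym/commrB; [ | exact: fC].
rewrite big_cons commp; last by move=> t z; apply/commr_sym/scalar_block_comm.
have p0' : \prod_(t <- l) (Y - t%:A) * (Y - u%:A) = 0.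
  rewrite -commp -?p0 ?big_cons // => t z.
  exact/commr_sym/alg_scalar_comm.
rewrite pE mx3_scalar mx3_opp mx3_add mx3_mul !mx3_simp subrr.
by rewrite !mulrA pC0 p0' !mx3_simp mx3_0.
Qed.

(** The image of e lies in the first block, which y preserves. *)
Lemma block_power_entry (S : comNzRingType) (D : algType S)
    (y a b x x' z : D) d (c : 'I_d -> S) :
  \sum_j ((c j)%:A)%:M * (mx3 y 0 x 0 y x' 0 0 z ^+ j * mx3 0 a b 0 0 0 0 0 0)
    = 0 -> \sum_j c j *: (y ^+ j * a) = 0.
Proof.
have pE k : mx3 y 0 x 0 y x' 0 0 z ^+ k * mx3 0 a b 0 0 0 0 0 0 =
    mx3 0 (y ^+ k * a) (y ^+ k * b) 0 0 0 0 0 0.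
  elim: k => [|k IH]; first by rewrite !expr0 !mul1r.
  by rewrite !exprS -mulrA IH mx3_mul !mx3_simp !mulrA.
move=> /matrixP/(_ 0 1); rewrite summxE [RHS]mxE => c0.
rewrite -[RHS]c0; apply: eq_bigr => j _.
by rewrite pE mx3_scalar mx3_mul mxE /= !mx3_simp mulr_algl.
Qed.

(** * The block module, degenerate case *)

Section DegenerateBlock.
Variables (S : comNzRingType) (D : algType S).
Variables (s y P : D) (u : S) (l : seq S).
Hypotheses (ss : s * s = 1) (sy : s * y = - (y * s) - 1).
Hypotheses (sP : s * P = P) (Py : P * y = u *: P) (PP : P * P = P).
Hypotheses (lP : \prod_(b <- l) (y - b%:A) * (P - 1) = 0).
Hypotheses (ly : \prod_(b <- u :: l) (y - b%:A) = 0).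

(** The triple (a, f, h) stands for a + f t + s h t, where w = s t satisfies
    y w = u w and e w generates the first block.  This forces
      s (s h t) = h t,    e (f t) = e (s f t) = P s f,
      y (s h t) = s y' h t + (e - 1) h t
    with y' t = s y s t - (e - 1) s t = u t + s t - e, hence the columns below; y'
    is then s y s - (e - 1) s. *)
Definition dblock_s : 'M[D]_3 := mx3 s 0 0 0 0 1 0 1 0.
Definition dblock_e : 'M[D]_3 := mx3 0 (P * s) (P * s) 0 0 0 0 0 0.
Definition dblock_y : 'M[D]_3 :=
  mx3 y 0 ((P - 1) * s) 0 y (P - 1) 0 0 u%:A.
Definition dblock_y' : 'M[D]_3 :=
  mx3 (- y) (- 1) (- (P * s)) 0 u%:A 1 0 P y.

Lemma dblock_relations : dBMW2_relations (fun c => (c%:A)%:M : 'M[D]_3)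
  (fun=> 0) (u :: l) dblock_s dblock_e dblock_y dblock_y'.
Proof.
have sPK z : s * (P * z) = P * z by rewrite mulrA sP.
have aK k x : k%:A * x = k *: x :> D by apply: mulr_algl.
have aR k x : x * k%:A = k *: x :> D by apply: mulr_algr.
split.
- by rewrite mx3_mul !mx3_simp ss mx3_1.
- move=> a; rewrite scale0r -scalemx1 scale0r mul0r.
  have [t [t' ->]] : exists t t', dblock_e * dblock_y ^+ a = mx3 0 t t' 0 0 0 0 0 0.
    elim: a => [|a [t [t' IHa]]]; first by rewrite mulr1; do 2!eexists.
    by rewrite exprSr mulrA IHa mx3_mul !mx3_simp; do 2!eexists.
  by rewrite mx3_mul !mx3_simp mx3_0.
- have PsPE : (P - 1) * s * P = 0 by rewrite mulrBl mul1r mulrBl sP -mulrA sP PP subrr.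
  rewrite !mx3_mul !mx3_simp !aK !aR; apply: eq_mx3 => //.
  + by rewrite mulrN mulNr.
  + by rewrite mulrN1 mulN1r PsPE addr0.
  + have -> : (P - 1) * s * y = - (u *: (P * s)) - P + y * s + 1.
      rewrite -mulrA sy mulrBl mul1r mulrBr mulrN mulr1 mulrA Py scalerAl.
      by rewrite opprB opprK addrA addrAC.
    rewrite mulrBl mul1r !mulrN mulrBr !mulNr mul1r scalerN opprB.
    by rewrite opprK !addrA [LHS](ACl (1*4*5*3*2)).
  + by rewrite mulrBl PP mul1r subrr addr0.
  + by rewrite mulrBl Py mul1r addrC subrK scalerBr subrK.
  + by rewrite mulrBr PP mulr1 subrr add0r.
- by rewrite mx3_mul !mx3_simp.
- by rewrite mx3_mul !mx3_simp sPK.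
- rewrite !mx3_mul !mx3_simp -mx3_1 !mx3_opp !mx3_add !mx3_simp.
  rewrite !subrr !opprK [P - 1 - P]addrAC subrr add0r.
  rewrite mulNr opprK sy addrAC addNr add0r.
  by rewrite mulrBl mul1r mulrBr sPK ss subrK.
- rewrite !mx3_mul !mx3_simp -mx3_1 !mx3_opp !mx3_add !mx3_simp.
  rewrite !subrr [P - 1 - P]addrAC subrr add0r !mulrN mulr1 !opprK sPK.
  by rewrite sy addrA subrr add0r mulrBl mul1r subrK.
- have PsyP : P * s * (y + u%:A) = - P.
    rewrite mulrDr -mulrA sy aR mulrBr mulrN mulr1 mulrA Py -scalerAl.
    by rewrite addrAC addNr add0r.
  rewrite !mx3_add !mx3_mul !mx3_simp [u%:A + y]addrC subrK PsyP.
  by rewrite -mulrA sP PP addNr subrr mx3_0.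
- by rewrite !mx3_add !mx3_mul !mx3_simp subrr !mul0r mx3_0.
- by rewrite -(triangular_cyclotomic s 1 lP ly) mulr1.
Qed.
End DegenerateBlock.

(** * The block module, non-degenerate case *)

Section NonDegenerateBlock.
(* Z is a variable and not q - q^-1, which distributivity rewrites would open. *)
Variables (S : comUnitRingType) (D : algType S) (L M Z : S).
Variables (g gi y yi P : D) (u : S) (l : seq S).
Hypotheses (ML : M * L = 1) (LM : L - M = Z) (uu : u \is a GRing.unit).
Hypotheses (ggi : g * gi = 1) (gig : gi * g = 1) (skein : g - gi = Z%:A).
Hypotheses (yyi : y * yi = 1) (yiy : yi * y = 1).
Hypotheses (gygy : g * y * g * y = 1).
Hypotheses (gP : g * P = L *: P) (Py : P * y = u *: P) (PP : P * P = P).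
Hypotheses (lP : \prod_(b <- l) (y - b%:A) * (P - 1) = 0).
Hypotheses (ly : \prod_(b <- u :: l) (y - b%:A) = 0).

(** As in the degenerate case (a, f, h) stands for a + f t + g h t with
    y (g t) = u (g t), up to rescaling the first block.  Now
      g (g h t) = h t + Z (g h t - L e h t),
      y (g h t) = g^-1 h (g y g) t,
    and g y g acts on V as y^-1.  L and M are rho^-1 and rho. *)
Definition block_g : 'M[D]_3 :=
  mx3 g 0 (- ((Z * L) *: (P * gi))) 0 0 1 0 1 Z%:A.
Definition block_gi : 'M[D]_3 :=
  mx3 gi (Z *: (P * gi)) 0 0 (- Z%:A) 1 0 1 0.
Definition block_e : 'M[D]_3 := mx3 0 (P * gi) (L *: (P * gi)) 0 0 0 0 0 0.
Definition block_y : 'M[D]_3 :=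
  mx3 y 0 ((u * Z) *: ((P - 1) * gi)) 0 y ((u * Z) *: (P - 1)) 0 0 u%:A.
Definition block_yi : 'M[D]_3 :=
  mx3 yi 0 (- (Z *: (yi * (P - 1) * gi))) 0 yi (- (Z *: (yi * (P - 1))))
      0 0 (u^-1)%:A.
Definition block_gyg : 'M[D]_3 :=
  mx3 yi (- (u * Z)%:A) (- (Z *: (yi * P * gi)) - (u * Z * Z)%:A)
      0 u%:A (u * Z)%:A
      0 ((u * Z) *: P) (y + (u * Z * Z) *: P).

Let aK k x : k%:A * x = k *: x :> D. Proof. exact: mulr_algl. Qed.
Let aR k x : x * k%:A = k *: x :> D. Proof. exact: mulr_algr. Qed.

Let LL : L * L = 1 + Z * L.
Proof. by rewrite -LM mulrBl ML addrC subrK. Qed.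

Let giE : gi = g - Z%:A.
Proof. by rewrite -skein opprB addrC subrK. Qed.

Let giP : gi * P = M *: P.
Proof. by rewrite giE mulrBl gP aK -scalerBl -LM opprB addrC subrK. Qed.

Let Pyi : P * yi = u^-1 *: P.
Proof.
by rewrite -[P in LHS]scale1r -(mulVr uu) -scalerA -Py -scalerAl -mulrA yyi mulr1.
Qed.

Let CP : (P - 1) * P = 0. Proof. by rewrite mulrBl PP mul1r subrr. Qed.
Let PC : P * (P - 1) = 0. Proof. by rewrite mulrBr PP mulr1 subrr. Qed.
Let CgiP : (P - 1) * gi * P = 0.
Proof. by rewrite -mulrA giP -scalerAr CP scaler0. Qed.

Let gy : g * y = yi * gi.
Proof.
have : g * y * (g * y) * (yi * gi) = yi * gi by rewrite !mulrA gygy mul1r.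
by rewrite -mulrA -[g * y * (yi * gi)]mulrA [y * (yi * gi)]mulrA yyi mul1r ggi mulr1.
Qed.

Let gyg : g * y * g = yi.
Proof. by rewrite gy -mulrA gig mulr1. Qed.

Let giy : gi * y = yi * gi - Z *: y.
Proof. by rewrite giE mulrBl gy aK giE. Qed.

Let Pgiy : P * gi * y = u^-1 *: (P * gi) - (Z * u) *: P.
Proof. by rewrite -mulrA giy mulrBr -scalerAr Py mulrA Pyi scalerA scalerAl. Qed.

Lemma block_g_y_g : block_g * block_y * block_g = block_gyg.
Proof.
have gCgi : g * ((P - 1) * gi) = L *: (P * gi) - 1.
  by rewrite mulrA mulrBr gP mulr1 mulrBl ggi scalerAl.
have E12 : g * ((u * Z) *: ((P - 1) * gi)) + u *: - ((Z * L) *: (P * gi)) =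
    - (u * Z)%:A.
  rewrite -scalerAr gCgi scalerBr !scalerN !scalerA mulrA addrAC subrr.
  by rewrite add0r.
have ZC : (u * Z) *: (P - 1) + (Z * u)%:A = (u * Z) *: P.
  by rewrite [Z * u]mulrC -scalerDr subrK.
rewrite !mx3_mul !mx3_simp !aK !aR !scalerA E12 ZC.
apply: eq_mx3 => //; last by rewrite scalerA [Z * _]mulrC.
rewrite scalerN scalerA [Z * (u * Z)]mulrC; congr (_ - _).
rewrite mulrN -scalerAr gy -[yi * gi * _]mulrA [gi * (P * gi)]mulrA giP.
by rewrite -scalerAl -scalerAr scalerA -[Z * L * _]mulrA [L * M]mulrC ML mulr1 mulrA.
Qed.

Lemma block_y_gyg : block_y * block_gyg = block_gyg * block_y.
Proof.
rewrite !mx3_mul !mx3_simp !aK !aR !scalerA yyi yiy.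
have CPk k k' : k *: (P - 1) * (k' *: P) = 0.
  by rewrite -scalerAl -scalerAr CP !scaler0.
have CgiPk k k' : k *: ((P - 1) * gi) * (k' *: P) = 0.
  by rewrite -scalerAl -scalerAr CgiP !scaler0.
have PCk k k' : k *: P * (k' *: (P - 1)) = 0.
  by rewrite -scalerAl -scalerAr PC !scaler0.
rewrite CPk CgiPk PCk !addr0 add0r; apply: eq_mx3 => //.
- by rewrite mulrN aR mulNr aK.
- rewrite mulrBr mulrN -scalerAr !mulrA yyi mul1r aR.
  rewrite [X in _ + X]mulrDr CgiPk addr0 -scalerAl -scalerAr mulNr aK scalerA.
  rewrite mulrBl mul1r mulrBl Pgiy giy.
  have -> : u * Z * (u * Z) = u * (u * Z * Z) by rewrite mulrCA !mulrA.
  have -> : (u * Z) *: (u^-1 *: (P * gi) - (Z * u) *: P - (yi * gi - Z *: y)) =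
      Z *: (P * gi) + (u * Z * Z) *: y
      - (u * (u * Z * Z)) *: P - (u * Z) *: (yi * gi).
    rewrite opprB !scalerDr !scalerN !scalerA [u * Z / u]mulrAC divrr // mul1r.
    by rewrite [u * Z * (Z * u)]mulrA [u * Z * Z * u]mulrC !addrA
      [LHS](ACl (1*3*2*4)).
  rewrite mulrBr [yi * (P * gi)]mulrA !scalerBr !scalerN scalerA opprB !addrA.
  rewrite [LHS](ACl (1*3*(2*4)*6*5)) /= !addNr !add0r.
  by rewrite scalerA [RHS](ACl (1*5*(3*6)*2*4)) /= !subrr !add0r.
- rewrite [X in _ + X]mulrDr CPk addr0 -scalerAl mulrBl mul1r Py.
  by rewrite scalerBr addrC subrK scalerA -mulrA [Z * u]mulrC -scalerDr subrK.
- by rewrite -scalerAl Py !scalerA -mulrA [Z * u]mulrC.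
Qed.

Lemma block_relations (rho q : S) :
  L = rho^-1 -> Z = q - q^-1 ->
  BMW2_relations (fun c => (c%:A)%:M : 'M[D]_3) rho q (fun=> 0)
    (u :: l) block_g block_gi block_e block_y block_yi.
Proof.
move=> LE ZE; have eyg : block_e * block_y * block_g * block_y * block_g = block_e.
  pose X := (u * Z * M) *: P + (u * M) *: (P * gi).
  have XP : X * P = u *: P.
    rewrite /X mulrDl -!scalerAl PP -[P * gi * P]mulrA giP -scalerAr PP scalerA.
    rewrite -scalerDl.
    by rewrite -mulrA -mulrA -mulrDr -mulrDl -LM subrK [L * M]mulrC ML mulr1.
  have Xy : X * y = M *: (P * gi).
    rewrite /X mulrDl -!scalerAl Py Pgiy scalerBr !scalerA [u * M / u]mulrAC.
    rewrite divrr // mul1r addrC -addrA.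
    have -> : u * M * (Z * u) = u * Z * M * u by ring.
    by rewrite addNr addr0.
  have ey : block_e * block_y = mx3 0 (P * gi * y) X 0 0 0 0 0 0.
    rewrite mx3_mul !mx3_simp aR; apply: eq_mx3 => //.
    rewrite /X -scalerAr mulrBr mulr1 -[P * gi * P]mulrA giP -scalerAr PP.
    rewrite scalerBr scalerA -addrA; congr (_ + _).
    by rewrite scalerA addrC -scalerBl -mulrBr -LM opprB addrC subrK.
  rewrite -!mulrA [block_g * (block_y * _)]mulrA block_g_y_g mulrA ey.
  rewrite mx3_mul !mx3_simp !aR -!scalerAr XP mulrDr Xy -scalerAr XP Pgiy.
  apply: eq_mx3 => //.
    rewrite scalerBr !scalerA divrr // scale1r.
    have -> : u * Z * u = u * (Z * u) by ring.
    by rewrite subrK.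
  rewrite scalerBr !scalerA [u * Z / u]mulrAC divrr // mul1r.
  have -> : u * Z * Z * u = u * Z * (Z * u) by ring.
  rewrite addrA [LHS](ACl (1*3*(2*4))) /= addNr addr0 -scalerDl.
  by rewrite -LM subrK.
have gygy' : block_g * block_y * block_g * block_y * block_e = block_e.
  rewrite block_g_y_g -block_y_gyg -mulrA !mx3_mul !mx3_simp.
  by rewrite -!scalerAr ![y * _]mulrA yyi !mul1r.
have skein3 : block_g - block_gi = (Z%:A)%:M * (1 - block_e).
  rewrite mx3_scalar -mx3_1 !mx3_opp !mx3_add !mx3_mul !mx3_simp !aK.
  by rewrite skein !subrr opprK !scalerN scalerA.
split; rewrite -?LE -?ZE //.
- rewrite mx3_mul !mx3_simp ?aR -mx3_1 ggi addNr -!scalerAr mulrA gP.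
  by rewrite -scalerAl scalerA subrr.
- rewrite mx3_mul !mx3_simp ?aR -mx3_1 gig addNr mulrN -scalerAr mulrA giP.
  by rewrite -scalerAl scalerA -mulrA [L * M]mulrC ML mulr1 addNr.
- rewrite mx3_mul !mx3_simp !aR !scalerA -mx3_1 yyi mulVr // scale1r.
  rewrite [u^-1 * (u * Z)]mulrA mulVr // mul1r !mulrN -!scalerAr !mulrA.
  by rewrite yyi !mul1r !addNr.
- rewrite mx3_mul !mx3_simp !aK !aR -mx3_1 yiy scalerA mulVr // scale1r.
  by rewrite -!scalerAr !scalerN !scalerA !mulrA !subrr.
- by rewrite -!mulrA [block_g * (block_y * block_g)]mulrA block_g_y_g
    block_y_gyg -block_g_y_g !mulrA.
- move=> a; rewrite scale0r -scalemx1 scale0r mul0r.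
  have [t [t' ->]] : exists t t', block_e * block_y ^+ a = mx3 0 t t' 0 0 0 0 0 0.
    elim: a => [|a [t [t' IHa]]]; first by rewrite mulr1; do 2!eexists.
    by rewrite exprSr mulrA IHa mx3_mul !mx3_simp; do 2!eexists.
  by rewrite mx3_mul !mx3_simp mx3_0.
- rewrite mx3_scalar !mx3_mul !mx3_simp !aK -scalerAr mulrA gP.
  by rewrite -scalerAl.
- by rewrite mx3_scalar !mx3_mul !mx3_simp !aK !aR !scalerA LL scalerDl scale1r.
- have := triangular_cyclotomic ((u * Z) *: gi) (u * Z)%:A lP ly.
  by rewrite -scalerAr aR.
Qed.
End NonDegenerateBlock.

(** * Matrices of the action on the left ideal *)

Section CyclicModule.
Variables (S : comNzRingType) (F : algType S) (R : F -> F -> Prop).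
Local Notation A := (quot_algebra R).
Variables (y e : A) (m : nat).
Local Notation d := m.+1.

Definition vec (c : 'cV[S]_d) : A := \sum_(i < d) c i 0 *: (y ^+ i * e).

(** A matrix is recorded by its effect on all combinations of the y^i e: it is
    unique only once the y^i e are independent, while products and sums need no
    independence. *)
Definition acts (a : A) (M : 'M[S]_d) := forall c, a * vec c = vec (M *m c).

Definition in_span (z : A) := exists c, z = vec c.

Lemma vec_linear k c c' : vec (k *: c + c') = k *: vec c + vec c'.
Proof.
rewrite /vec scaler_sumr -big_split; apply: eq_bigr => i _ /=.
by rewrite !mxE scalerDl scalerA.
Qed.

Lemma vec_delta (i : 'I_d) : vec (delta_mx i 0) = y ^+ i * e.
Proof.
rewrite /vec (bigD1 i) //= mxE !eqxx scale1r big1 ?addr0 // => j ji.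
by rewrite mxE (negPf ji) scale0r.
Qed.

Lemma vec0 : vec 0 = 0.
Proof. by rewrite /vec big1 // => i _; rewrite mxE scale0r. Qed.

Lemma mul_vec_sum (a : A) c : a * vec c = \sum_(i < d) c i 0 *: (a * (y ^+ i * e)).
Proof. by rewrite /vec mulr_sumr; apply: eq_bigr => i _; rewrite -quot_scalerAr. Qed.

Lemma acts_basis a M :
  (forall i : 'I_d, a * (y ^+ i * e) = vec (M *m delta_mx i 0)) -> acts a M.
Proof.
move=> aM c; rewrite mul_vec_sum [c in RHS]matrix_sum_delta.
rewrite (eq_bigr (fun i => c i 0 *: delta_mx i 0)) => [|i _]; last first.
  by rewrite big_ord1.
rewrite mulmx_sumr; elim/big_rec2: _ => [|i v z _ IH]; first by rewrite vec0.
by rewrite -scalemxAr vec_linear -aM -IH.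
Qed.

Lemma acts1 : acts 1 1. Proof. by move=> c; rewrite mul1r mul1mx. Qed.
Lemma acts0 : acts 0 0. Proof. by move=> c; rewrite mul0r mul0mx vec0. Qed.

Lemma actsM a b M N : acts a M -> acts b N -> acts (a * b) (M * N).
Proof. by move=> aM bN c; rewrite -mulrA bN aM mulmxA. Qed.

Lemma actsD a b M N : acts a M -> acts b N -> acts (a + b) (M + N).
Proof.
move=> aM bN c; have := vec_linear 1 (M *m c) (N *m c); rewrite !scale1r => MN.
by rewrite mulrDl aM bN mulmxDl MN.
Qed.

Lemma actsZ k a M : acts a M -> acts (k *: a) (k *: M).
Proof.
move=> aM c; rewrite -quot_scalerAl aM -scalemxAl -[k *: (M *m c)]addr0 vec_linear.
by rewrite vec0 addr0.
Qed.

Lemma actsB a b M N : acts a M -> acts b N -> acts (a - b) (M - N).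
Proof.
by move=> aM bN; rewrite -!scaleN1r; apply: actsD => //; apply: actsZ.
Qed.

Lemma actsX a M k : acts a M -> acts (a ^+ k) (M ^+ k).
Proof.
move=> aM; elim: k => [|k IH]; first exact: acts1.
by rewrite !exprS; apply: actsM.
Qed.

Lemma in_span_acts a :
  (forall i : 'I_d, in_span (a * (y ^+ i * e))) -> exists M, acts a M.
Proof.
move=> aV; pose c i := projT1 (cid (aV i)).
exists (\matrix_(i, j) c j i 0); apply: acts_basis => i.
rewrite (projT2 (cid (aV i))) -/(c i); congr vec; apply/colP => j.
rewrite mxE (bigD1 i) //= !mxE !eqxx mulr1 big1 ?addr0 // => k ki.
by rewrite [X in _ * X]mxE (negPf ki) mulr0.
Qed.

Lemma in_spanD z t : in_span z -> in_span t -> in_span (z + t).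
Proof.
by move=> [c ->] [c' ->]; exists (1 *: c + c'); rewrite vec_linear scale1r.
Qed.

Lemma in_spanZ k z : in_span z -> in_span (k *: z).
Proof. by move=> [c ->]; exists (k *: c + 0); rewrite vec_linear vec0 addr0. Qed.

Lemma in_spanN z : in_span z -> in_span (- z).
Proof. by move=> zV; rewrite -scaleN1r; apply: in_spanZ. Qed.

Lemma in_span_sum I (r : seq I) (z : I -> A) :
  (forall i, in_span (z i)) -> in_span (\sum_(i <- r) z i).
Proof.
move=> zV; elim/big_rec: _ => [|i t _ tV]; last exact: in_spanD.
by exists 0; rewrite vec0.
Qed.

Lemma in_span_act a M z : acts a M -> in_span z -> in_span (a * z).
Proof. by move=> aM [c ->]; exists (M *m c). Qed.

Hypothesis indep : lin_indep (fun i : 'I_d => y ^+ i * e).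

Lemma vec_inj : injective vec.
Proof.
move=> c c' cc'; apply/colP => i; apply/eqP; rewrite -subr_eq0; apply/eqP.
apply: (indep (c := fun i => c i 0 - c' i 0)) i.
transitivity (vec (-1 *: c' + c)); last by rewrite vec_linear cc' scaleN1r addNr.
by apply: eq_bigr => i _; rewrite !mxE mulN1r addrC.
Qed.

Lemma acts_vec a M x k : acts a M -> a * vec x = k *: e ->
  M *m x = k *: delta_mx 0 0.
Proof.
move=> aM ax; apply: vec_inj; rewrite -aM ax -[X in _ = vec X]addr0 vec_linear.
by rewrite vec0 addr0 vec_delta mul1r.
Qed.

Lemma acts_inj a b M N : acts a M -> acts b N ->
  (forall k, a * (y ^+ k * e) = b * (y ^+ k * e)) -> M = N.
Proof.
move=> aM bN ab; apply/matrixP=> i j.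
have: M *m delta_mx j 0 = N *m delta_mx j 0 :> 'cV_d.
  by apply: vec_inj; rewrite -aM -bN vec_delta ab.
by rewrite -!colE => /colP /(_ i); rewrite !mxE.
Qed.

Section Annihilator.
Variables (p : {poly S}).
Hypotheses (p_monic : p \is monic) (p_size : size p = d.+1).
Hypothesis p_annihilates : (\sum_(j < d.+1) p`_j *: y ^+ j) * e = 0.

(** As p is monic of degree d, y^d e is a combination of the y^i e with i < d. *)
Lemma in_span_power k : in_span (y ^+ k * e).
Proof.
have ySV (i : 'I_d) : in_span (y * (y ^+ i * e)).
  rewrite mulrA -exprS.
  have [ltid|] := ltnP i.+1 d.
    by exists (delta_mx (Ordinal ltid) 0); rewrite vec_delta.
  move=> le_di; have -> : i.+1 = d by apply/eqP; rewrite eqn_leq le_di ltn_ord.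
  have pd : p`_d = 1 by have /monicP := p_monic; rewrite /lead_coef p_size.
  move: p_annihilates; rewrite big_ord_recr /= pd scale1r mulrDl addrC.
  move/eqP; rewrite addr_eq0 => /eqP ->; apply: in_spanN.
  exists (\col_i p`_i); rewrite /vec mulr_suml; apply: eq_bigr => j _.
  by rewrite mxE quot_scalerAl.
have [Y yY] := in_span_acts ySV.
elim: k => [|k IH]; last by rewrite exprS -mulrA; apply: in_span_act yY _.
by exists (delta_mx 0 0); rewrite vec_delta.
Qed.

Variable Y : 'M[S]_d.
Hypothesis yY : acts y Y.

Lemma horner_alg_wide n (h : {poly S}) : (size h <= n)%N ->
  horner_alg Y h = \sum_(j < n) h`_j *: Y ^+ j.
Proof.
move=> hn; have {1}-> : h = \sum_(j < n) h`_j *: 'X^j.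
  rewrite -poly_def; apply/polyP => j; rewrite coef_poly.
  by case: ltnP => // /(leq_trans hn) /(nth_default 0).
rewrite linear_sum; apply: eq_bigr => j _.
by rewrite linearZ /= rmorphXn /= horner_algX mulr_algl.
Qed.

(** p(y) commutes with y, so it kills every y^k e together with e. *)
Lemma horner_annihilator : horner_alg Y p = 0.
Proof.
rewrite (@horner_alg_wide d.+1) ?p_size //.
have pY : acts (\sum_(j < d.+1) p`_j *: y ^+ j) (\sum_(j < d.+1) p`_j *: Y ^+ j).
  elim/big_rec2: _ => [|j M a _ aM]; first exact: acts0.
  by apply: actsD => //; apply/actsZ/actsX.
have A0 : acts (0 : A) (0 : 'M[S]_d) by exact: acts0.
apply: (acts_inj pY A0) => k.
have yC : GRing.comm (\sum_(j < d.+1) p`_j *: y ^+ j) (y ^+ k).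
  apply: commr_sym; apply: commr_sum => i _.
  by rewrite /GRing.comm -quot_scalerAr -quot_scalerAl -!exprD addnC.
by rewrite mulrA yC -mulrA p_annihilates mulr0 mul0r.
Qed.

Lemma power_delta0 (i : 'I_d) : Y ^+ i *m delta_mx 0 0 = delta_mx i 0 :> 'cV_d.
Proof.
by apply: vec_inj; rewrite vec_delta -(actsX _ yY) vec_delta expr0 mul1r.
Qed.

(** The row of the powers of u is, on V, the evaluation f(y) e |-> f(u); it is well
    defined because u is a root of p. *)
Lemma horner_alg_delta0 (u : S) (h : {poly S}) : root p u ->
  (\row_j u ^+ j) *m (horner_alg Y h *m delta_mx 0 0) = h.[u]%:M :> 'M_1.
Proof.
move=> /rootP pu0; rewrite {1}(Pdiv.RingMonic.rdivp_eq p_monic h).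
set r := Pdiv.Ring.rmodp h p.
have size_r : (size r <= d)%N.
  by rewrite -ltnS -p_size Pdiv.Ring.ltn_rmodpN0 // monic_neq0.
have -> : h.[u] = r.[u].
  by rewrite {1}(Pdiv.RingMonic.rdivp_eq p_monic h) hornerD hornerM pu0 mulr0 add0r.
rewrite rmorphD rmorphM /= horner_annihilator mulr0 add0r (horner_alg_wide size_r).
rewrite mulmx_suml mulmx_sumr (horner_coef_wide u size_r).
apply/matrixP => i j; rewrite !ord1 summxE mxE mulr1n; apply: eq_bigr => k _.
by rewrite -scalemxAl power_delta0 -scalemxAr -colE !mxE.
Qed.

Lemma horner_alg_prod (r : seq S) :
  \prod_(b <- r) (Y - b%:A) = horner_alg Y (\prod_(b <- r) ('X - b%:P)).
Proof.
rewrite rmorph_prod; apply: eq_bigr => b _.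
by rewrite rmorphB /= horner_algX horner_algC.
Qed.

(** P is f(y) e |-> f(u) e, a projection onto the line of e.  If l lists the other
    roots of p, then prod_(b <- l) (X - b) * (X^j - u^j) is a multiple of p, and so
    prod_(b <- l) (Y - b) identifies y^j e with u^j e. *)
Lemma eigenprojection (u : S) (l : seq S) : p = \prod_(b <- u :: l) ('X - b%:P) ->
  exists P : 'M[S]_d,
  [/\ P * Y = u *: P, P * P = P, P *m delta_mx 0 0 = delta_mx 0 0 :> 'cV_d,
     forall N k, N *m delta_mx 0 0 = k *: delta_mx 0 0 :> 'cV_d -> N * P = k *: P
   & \prod_(b <- l) (Y - b%:A) * (P - 1) = 0].
Proof.
move=> pE.
have pu : root p u by rewrite /root pE big_cons hornerM hornerXsubC subrr mul0r.
pose ell : 'rV[S]_d := \row_j u ^+ j.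
have ellY k : ell *m (Y ^+ k *m delta_mx 0 0) = (u ^+ k)%:M :> 'M_1.
  have := horner_alg_delta0 'X^k pu.
  by rewrite rmorphXn /= horner_algX hornerXn.
have P0 : delta_mx 0 0 *m ell *m delta_mx 0 0 = delta_mx 0 0 :> 'cV_d.
  by rewrite -mulmxA; have /= := ellY 0%N; rewrite expr0 mul1mx => ->; rewrite mulmx1.
have Pk N k : N *m delta_mx 0 0 = k *: delta_mx 0 0 :> 'cV_d ->
    N * (delta_mx 0 0 *m ell) = k *: (delta_mx 0 0 *m ell).
  by move=> Nk; rewrite -[N * _]/(N *m _) mulmxA Nk -scalemxAl.
exists (delta_mx 0 0 *m ell); split=> //.
- rewrite -[_ * Y]mulmxA scalemxAr; congr (_ *m _).
  apply/rowP => j; rewrite 2!mxE.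
  have /matrixP/(_ 0 0) := ellY j.+1; rewrite exprS -[Y * _ *m _]mulmxA power_delta0.
  by rewrite mulmxA -colE !mxE eqxx mulr1n exprS.
- by rewrite -[RHS]scale1r; apply: Pk; rewrite P0 scale1r.
- rewrite horner_alg_prod; set pl := \prod_(b <- l) _.
  apply/eqP; rewrite mulrBr mulr1 subr_eq0; apply/eqP/matrixP => i j.
  have: horner_alg Y pl *m (delta_mx 0 0 *m ell) *m delta_mx j 0 =
        horner_alg Y pl *m delta_mx j 0 :> 'cV_d.
    rewrite -(power_delta0 j) -!mulmxA ellY.
    have [t Xt] : exists t, 'X^j - (u ^+ j)%:P = t * ('X - u%:P).
      by apply/factor_theorem; rewrite /root hornerD hornerN hornerXn hornerC subrr.
    have Yj : horner_alg Y pl * Y ^+ j = u ^+ j *: horner_alg Y pl.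
      have -> : horner_alg Y pl * Y ^+ j = horner_alg Y (pl * 'X^j).
        by rewrite rmorphM rmorphXn /= horner_algX.
      have -> : pl * 'X^j = p * t + u ^+ j *: pl.
        rewrite pE big_cons -/pl -['X^j](subrK (u ^+ j)%:P) Xt -mul_polyC.
        by ring.
      by rewrite rmorphD rmorphM /= horner_annihilator mul0r add0r linearZ /= mulr_algl.
    have -> : horner_alg Y pl *m (Y ^+ j *m delta_mx 0 0) =
        u ^+ j *: horner_alg Y pl *m delta_mx 0 0 :> 'cV_d by rewrite -Yj -mulmxA.
    by rewrite mul_mx_scalar -scalemxAr scalemxAl.
  by rewrite -!colE => /colP /(_ i); rewrite !mxE.
Qed.
End Annihilator.
End CyclicModule.

(** N takes x to a multiple of the first basis vector, which the powers of Y then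
    move through the basis. *)
Lemma vanishing_combination (S : comNzRingType) (m : nat)
    (Y N : 'M[S]_m.+1) (x : 'cV[S]_m.+1) (k : S) (c : 'I_m.+1 -> S) :
  (forall i : 'I_m.+1, Y ^+ i *m delta_mx 0 0 = delta_mx i 0 :> 'cV_m.+1) ->
  N *m x = k *: delta_mx 0 0 ->
  \sum_j c j *: (Y ^+ j * N) = 0 -> forall j, k * c j = 0.
Proof.
move=> Yd Nx /(congr1 (fun M => M *m x)); rewrite mul0mx mulmx_suml => c0 j.
have /colP/(_ j) := c0; rewrite summxE (bigD1 j) //= big1 => [|i ij].
  by rewrite -scalemxAl -mulmxA Nx -scalemxAr Yd !mxE !eqxx mulr1 addr0 mulrC.
rewrite -scalemxAl -mulmxA Nx -scalemxAr Yd !mxE eq_sym.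
by rewrite (negPf ij) !mulr0.
Qed.

(** * Descent to the smaller set of parameters *)

Lemma omega_recurrence (S : comNzRingType) (F : algType S) (R : F -> F -> Prop)
    (omega : nat -> S) (p : {poly S}) d (y e : quot_algebra R) :
  (forall a, e * y ^+ a * e = omega a *: e) ->
  lin_indep (fun i : 'I_d => y ^+ i * e) -> (0 < d)%N ->
  (\sum_(j < d.+1) p`_j *: y ^+ j) * e = 0 ->
  forall l, \sum_(j < d.+1) p`_j * omega (j + l)%N = 0.
Proof.
move=> eye + d_gt0; case: d d_gt0 => // m _ indep py0 l.
set k := \sum_(j < _) _; suff ke0 : k *: e = 0.
  have := indep (fun i => if i == ord0 then k else 0) _ ord0; rewrite eqxx; apply.
  rewrite (bigD1 ord0) //= big1 => [|i /negPf ->]; last by rewrite scale0r.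
  by rewrite addr0 mul1r.
transitivity (e * y ^+ l * ((\sum_(j < m.+2) p`_j *: y ^+ j) * e)); last first.
  by rewrite py0 mulr0.
rewrite scaler_suml mulr_suml mulr_sumr; apply: eq_bigr => j _.
rewrite -quot_scalerAl -quot_scalerAr mulrA -[e * _ * _]mulrA -exprD eye.
by rewrite scalerA addnC.
Qed.

Section DegenerateDescent.
Variables (S : idomainType) (F : algType S) (R : F -> F -> Prop).
Variables (omega : nat -> S) (v : seq S) (u : S) (l : seq S).
Local Notation A := (quot_algebra R).
Variables (s e y y' : A).
Local Notation m := (size l).
Local Notation d := m.+1.
Hypothesis rels : dBMW2_relations (fun c => c *: (1 : A)) omega v s e y y'.
Hypothesis indep : lin_indep (fun i : 'I_d => y ^+ i * e).
Local Notation p := (\prod_(b <- u :: l) ('X - b%:P)).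
Hypothesis pye : (\sum_(j < d.+1) p`_j *: y ^+ j) * e = 0.

Let p_monic : p \is monic. Proof. exact: monic_prod_XsubC. Qed.
Let p_size : size p = d.+1. Proof. exact: size_prod_XsubC. Qed.

Let span_power k : in_span y e m (y ^+ k * e).
Proof. exact: in_span_power p_monic p_size pye k. Qed.

Let span_e : in_span y e m e.
Proof. by have := span_power 0; rewrite expr0 mul1r. Qed.

Let eye a : e * (y ^+ a * e) = omega a *: e.
Proof. by rewrite mulrA (dBMW2_eye rels) -quot_scalerAl mul1r. Qed.

Let y'y k : y' * (y ^+ k * e) = - (y ^+ k.+1 * e).
Proof.
have yC : GRing.comm y' (y ^+ k) by apply/commrX/esym/(dBMW2_yy rels).
have y'e : y' * e = - (y * e).
  by apply/eqP; rewrite -addr_eq0 addrC -mulrDl (dBMW2_yye rels).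
by rewrite mulrA yC -mulrA y'e mulrN mulrA -exprSr.
Qed.

Let sy k : s * (y ^+ k.+1 * e) =
  y' * (s * (y ^+ k * e)) + e * (y ^+ k * e) - y ^+ k * e.
Proof.
have -> : s * (y ^+ k.+1 * e) = s * y * (y ^+ k * e) by rewrite exprS !mulrA.
rewrite -[s * y](subrK (y' * s)) (dBMW2_sy rels).
by rewrite mulrDl mulrBl mul1r -[y' * s * _]mulrA addrC addrA.
Qed.

(** V is stable under s because s y = y' s + e - 1 and y' acts as -y. *)
Lemma dBMW2_descent : dBMW_admissible omega (u :: l).
Proof.
have [Y yY] : exists Y : 'M[S]_d, acts y e y Y.
  by apply: in_span_acts => i; rewrite mulrA -exprS.
have [E eE] : exists E : 'M[S]_d, acts y e e E.
  by apply: in_span_acts => i; rewrite eye; apply: in_spanZ.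
have [Y' yY'] : exists Y' : 'M[S]_d, acts y e y' Y'.
  by apply: in_span_acts => i; rewrite y'y; apply: in_spanN.
have [M sM] : exists M : 'M[S]_d, acts y e s M.
  apply: in_span_acts => i; elim: (i : nat) => [|k IH].
    by rewrite mul1r (dBMW2_se rels).
  rewrite sy; apply: in_spanD; last exact/in_spanN.
  apply: in_spanD; first exact: in_span_act yY' IH.
  by rewrite eye; apply: in_spanZ.
have eq_acts a b (N N' : 'M[S]_d) : acts y e a N -> acts y e b N' ->
    (forall k, a * (y ^+ k * e) = b * (y ^+ k * e)) -> N = N'.
  exact: (acts_inj indep).
have a1 : acts y e (1 : A) (1 : 'M[S]_d) by exact: acts1.
have a0 : acts y e (0 : A) (0 : 'M[S]_d) by exact: acts0.
have [P [Py PP P0 Pk lP]] := eigenprojection indep p_monic p_size pye yY erefl.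
have lY : \prod_(b <- u :: l) (Y - b%:A) = 0.
  by rewrite horner_alg_prod (horner_annihilator indep p_size pye yY).
have Yd := power_delta0 indep yY.
have MM : M * M = 1.
  by apply: eq_acts (actsM sM sM) a1 _ => k; rewrite (dBMW2_ss rels).
have sM_sy : M * Y - Y' * M = E - 1.
  apply: eq_acts (actsB (actsM sM yY) (actsM yY' sM)) (actsB eE a1) _ => j.
  by rewrite (dBMW2_sy rels).
have [[k wk]|w0] := EM (exists k, omega k != 0).
  have EY : dBMW2_relations (in_alg 'M[S]_d) omega (u :: l) M E Y Y'.
    have eyX a : acts y e (e * y ^+ a * e) (E * Y ^+ a * E).
      by exact: (actsM (actsM eE (actsX _ yY)) eE).
    split=> //=.
    - move=> a; rewrite mulr_algl; apply: eq_acts (eyX a) (actsZ _ eE) _ => j.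
      by rewrite (dBMW2_eye rels) -quot_scalerAl mul1r.
    - by apply: eq_acts (actsM yY yY') (actsM yY' yY) _ => j; rewrite (dBMW2_yy rels).
    - by apply: eq_acts (actsM eE sM) eE _ => j; rewrite (dBMW2_es rels).
    - by apply: eq_acts (actsM sM eE) eE _ => j; rewrite (dBMW2_se rels).
    - apply: eq_acts (actsB (actsM yY sM) (actsM sM yY')) (actsB eE a1) _ => j.
      by rewrite (dBMW2_ys rels).
    - apply: eq_acts (actsM eE (actsD yY yY')) a0 _ => j.
      by rewrite (dBMW2_eyy rels).
    - apply: eq_acts (actsM (actsD yY yY') eE) a0 _ => j.
      by rewrite (dBMW2_yye rels).
  move=> c /(dBMW2_eval (@alg_scalar_comm _ _) EY) c0 j.
  have [x xE] := span_power k.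
  have Ex : E *m x = omega k *: delta_mx 0 0.
    by apply: (acts_vec indep eE); rewrite -xE eye.
  have := vanishing_combination (c := c) Yd Ex _ j.
  rewrite -[RHS]c0; under [X in _ = X]eq_bigr do rewrite /= mulr_algl.
  by move=> /(_ erefl) /eqP; rewrite mulf_eq0 (negPf wk) => /eqP.
have omega0 : omega = fun=> 0.
  by apply/funext => a; apply/eqP/negPn/negP => wa; apply: w0; exists a.
have E0 : E = 0.
  by apply: eq_acts eE a0 _ => j; rewrite eye omega0 scale0r mul0r.
have MY' : Y' = - Y.
  by rewrite -sub0r; apply: eq_acts yY' (actsB a0 yY) _ => j;
    rewrite y'y sub0r mulNr mulrA -exprS.
have MY : M * Y = - (Y * M) - 1.
  by rewrite -[LHS](subrK (Y' * M)) sM_sy E0 MY' mulNr sub0r addrC.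
have M0 : M *m delta_mx 0 0 = 1 *: delta_mx 0 0 :> 'cV[S]_d.
  by apply: (acts_vec indep sM); rewrite vec_delta mul1r (dBMW2_se rels) scale1r.
have MP : M * P = P by rewrite (Pk _ _ M0) scale1r.
have block := dblock_relations MM MY MP Py PP lP lY.
pose iota : {rmorphism S -> 'M['M[S]_d]_3} := @scalar_mx 'M[S]_d 3 \o in_alg 'M[S]_d.
rewrite omega0 => c c0.
have := @dBMW2_eval S _ iota (@scalar_block_comm _ _) _ _ _ _ _ _ block _ c c0.
move=> /block_power_entry c1 j.
have PM0 : (P * M) *m delta_mx 0 0 = 1 *: delta_mx 0 0 :> 'cV[S]_d.
  by rewrite -mulmxA M0 scale1r P0.
by have := vanishing_combination Yd PM0 c1 j; rewrite mul1r.
Qed.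
End DegenerateDescent.

Section NonDegenerateDescent.
Variables (S : idomainType) (F : algType S) (R : F -> F -> Prop).
Variables (rho q : S) (omega : nat -> S) (v : seq S) (u : S) (l : seq S).
Local Notation A := (quot_algebra R).
Variables (g gi e y yi : A).
Local Notation m := (size l).
Local Notation d := m.+1.
Hypothesis rels :
  BMW2_relations (fun c => c *: (1 : A)) rho q omega v g gi e y yi.
Hypothesis rho_unit : rho \is a GRing.unit.
Hypothesis w_unit : {in u :: l, forall a, a \is a GRing.unit}.
Hypothesis rho_q : rho^-1 - rho = (q^-1 - q) * (omega 0%N - 1).
Hypothesis indep : lin_indep (fun i : 'I_d => y ^+ i * e).
Local Notation p := (\prod_(b <- u :: l) ('X - b%:P)).
Hypothesis pye : (\sum_(j < d.+1) p`_j *: y ^+ j) * e = 0.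

Let p_monic : p \is monic. Proof. exact: monic_prod_XsubC. Qed.
Let p_size : size p = d.+1. Proof. exact: size_prod_XsubC. Qed.

Let p0_unit : p`_0 \is a GRing.unit.
Proof.
rewrite -horner_coef0 horner_prod; elim: (u :: l) w_unit => [|a r IH] r_unit.
  by rewrite big_nil unitr1.
rewrite big_cons unitrM hornerXsubC sub0r unitrN r_unit ?mem_head //=.
by apply: IH => b br; apply: r_unit; rewrite inE br orbT.
Qed.

Let span_power k : in_span y e m (y ^+ k * e).
Proof. exact: in_span_power p_monic p_size pye k. Qed.

Let span_e : in_span y e m e.
Proof. by have := span_power 0; rewrite expr0 mul1r. Qed.

Let eye a : e * (y ^+ a * e) = omega a *: e.
Proof. by rewrite mulrA (BMW2_eye rels) -quot_scalerAl mul1r. Qed.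

Let yi_power k : yi * (y ^+ k.+1 * e) = y ^+ k * e.
Proof. by rewrite exprS !mulrA (BMW2_yiy rels) mul1r. Qed.

Let span_yi k : in_span y e m (yi * (y ^+ k * e)).
Proof.
case: k => [|k]; last by rewrite yi_power.
have yi_e : p`_0 *: (yi * e) = - \sum_(j < d) p`_j.+1 *: (y ^+ j * e).
  have := congr1 (fun z => yi * z) pye; rewrite mulr0 big_ord_recl mulrDl mulrDr.
  move/eqP; rewrite addr_eq0 -quot_scalerAl -quot_scalerAr expr0 !mul1r => /eqP ->.
  congr (- _); rewrite mulr_suml mulr_sumr; apply: eq_bigr => j _.
  by rewrite -quot_scalerAl -quot_scalerAr yi_power.
have -> : yi * (y ^+ 0 * e) = (p`_0)^-1 *: (p`_0 *: (yi * e)).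
  by rewrite scalerA mulVr // scale1r expr0 mul1r.
rewrite yi_e; apply/in_spanZ/in_spanN/in_span_sum => j.
exact: in_spanZ.
Qed.

Let gygy_power k : g * (y * (g * (y * (y ^+ k * e)))) = y ^+ k * e.
Proof.
have gC : GRing.comm (g * y * g * y) y.
  have := BMW2_ygyg rels; rewrite /GRing.comm => ygyg.
  by rewrite -{1}ygyg !mulrA.
have := commrX k gC; rewrite /GRing.comm => gCk.
transitivity (g * y * g * y * y ^+ k * e); first by rewrite !mulrA.
by rewrite gCk -mulrA (BMW2_gygye rels).
Qed.

Let gi_act z : gi * z = g * z - (q - q^-1) *: (z - e * z).
Proof.
have -> : gi = g - (q - q^-1) *: (1 - e).
  by have := BMW2_skein rels; rewrite -quot_scalerAl mul1r => <-; rewrite subKr.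
by rewrite mulrBl -quot_scalerAl mulrBl mul1r.
Qed.

(** V is stable under g because g y = (g y g) g^-1, where g y g acts as y^-1 and
    g^-1 = g - (q - q^-1) (1 - e); and under y^-1 because the constant term of p is,
    up to sign, the product of the units in u :: l. *)
Lemma BMW2_descent : BMW_admissible rho q omega (u :: l).
Proof.
have [Y yY] : exists Y : 'M[S]_d, acts y e y Y.
  by apply: in_span_acts => i; rewrite mulrA -exprS.
have [E eE] : exists E : 'M[S]_d, acts y e e E.
  by apply: in_span_acts => i; rewrite eye; apply: in_spanZ.
have [Yi yYi] : exists Yi : 'M[S]_d, acts y e yi Yi by apply: in_span_acts.
have gygy z : in_span y e m z -> g * (y * (g * (y * z))) = z.
  move=> [c ->]; rewrite mul_vec_sum !mulr_sumr; apply: eq_bigr => i _.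
  by rewrite -!quot_scalerAr gygy_power.
have span_gyg z : in_span y e m z -> in_span y e m (g * (y * (g * z))).
  move=> zV; have yiz : in_span y e m (yi * z) by apply: in_span_act yYi zV.
  by rewrite -[z]mul1r -(BMW2_yyi rels) -mulrA gygy.
have [G gG] : exists G : 'M[S]_d, acts y e g G.
  apply: in_span_acts => i; elim: (i : nat) => [|k IH].
    by rewrite mul1r (BMW2_ge rels) -quot_scalerAl mul1r; apply: in_spanZ.
  have -> : g * (y ^+ k.+1 * e) = g * (y * (g * (gi * (y ^+ k * e)))).
    by rewrite [g * (gi * _)]mulrA (BMW2_ggi rels) mul1r exprS !mulrA.
  apply: span_gyg; rewrite gi_act eye; apply: in_spanD => //.
  by apply/in_spanN/in_spanZ/in_spanD/in_spanN/in_spanZ.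
have a1 : acts y e (1 : A) (1 : 'M[S]_d) by exact: acts1.
have a0 : acts y e (0 : A) (0 : 'M[S]_d) by exact: acts0.
have [Gi gGi] : exists Gi : 'M[S]_d, acts y e gi Gi.
  have -> : gi = g - (q - q^-1) *: (1 - e).
    by have := BMW2_skein rels; rewrite -quot_scalerAl mul1r => <-; rewrite subKr.
  by eexists; apply: (actsB gG (actsZ _ (actsB a1 eE))).
have eq_acts a b (N N' : 'M[S]_d) : acts y e a N -> acts y e b N' ->
    (forall k, a * (y ^+ k * e) = b * (y ^+ k * e)) -> N = N'.
  exact: (acts_inj indep).
have [P [Py PP P0 Pk lP]] := eigenprojection indep p_monic p_size pye yY erefl.
have lY : \prod_(b <- u :: l) (Y - b%:A) = 0.
  by rewrite horner_alg_prod (horner_annihilator indep p_size pye yY).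
have Yd := power_delta0 indep yY.
have GGi : G * Gi = 1.
  by apply: eq_acts (actsM gG gGi) a1 _ => k; rewrite (BMW2_ggi rels).
have GiG : Gi * G = 1.
  by apply: eq_acts (actsM gGi gG) a1 _ => k; rewrite (BMW2_gig rels).
have YYi : Y * Yi = 1.
  by apply: eq_acts (actsM yY yYi) a1 _ => k; rewrite (BMW2_yyi rels).
have YiY : Yi * Y = 1.
  by apply: eq_acts (actsM yYi yY) a1 _ => k; rewrite (BMW2_yiy rels).
have skein : G - Gi = (q - q^-1) *: (1 - E).
  apply: eq_acts (actsB gG gGi) (actsZ _ (actsB a1 eE)) _ => k.
  by rewrite (BMW2_skein rels) -quot_scalerAl mul1r.
have [[k wk]|w0] := EM (exists k, omega k != 0).
  have EY : BMW2_relations (in_alg 'M[S]_d) rho q omega (u :: l) G Gi E Y Yi.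
    split=> //=.
    - apply: eq_acts (actsM (actsM (actsM yY gG) yY) gG)
        (actsM (actsM (actsM gG yY) gG) yY) _ => j.
      by rewrite (BMW2_ygyg rels).
    - move=> a; rewrite mulr_algl.
      apply: eq_acts (actsM (actsM eE (actsX a yY)) eE) (actsZ _ eE) _ => j.
      by rewrite (BMW2_eye rels) -quot_scalerAl mul1r.
    - rewrite mulr_algl; apply: eq_acts (actsM gG eE) (actsZ _ eE) _ => j.
      by rewrite (BMW2_ge rels) -quot_scalerAl mul1r.
    - rewrite mulr_algl; apply: eq_acts (actsM eE gG) (actsZ _ eE) _ => j.
      by rewrite (BMW2_eg rels) -quot_scalerAl mul1r.
    - by rewrite mulr_algl.
    - apply: eq_acts (actsM (actsM (actsM (actsM eE yY) gG) yY) gG) eE _ => j.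
      by rewrite (BMW2_eygyg rels).
    - apply: eq_acts (actsM (actsM (actsM (actsM gG yY) gG) yY) eE) eE _ => j.
      by rewrite (BMW2_gygye rels).
  move=> c /(BMW2_eval (@alg_scalar_comm _ _) EY) c0 j.
  have [x xE] := span_power k.
  have Ex : E *m x = omega k *: delta_mx 0 0.
    by apply: (acts_vec indep eE); rewrite -xE eye.
  have := vanishing_combination (c := c) Yd Ex _ j.
  rewrite -[RHS]c0; under [X in _ = X]eq_bigr do rewrite /= mulr_algl.
  by move=> /(_ erefl) /eqP; rewrite mulf_eq0 (negPf wk) => /eqP.
have omega0 : omega = fun=> 0.
  by apply/funext => a; apply/eqP/negPn/negP => wa; apply: w0; exists a.
have E0 : E = 0.
  by apply: eq_acts eE a0 _ => j; rewrite eye omega0 scale0r mul0r.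
have skein0 : G - Gi = (q - q^-1)%:A by rewrite skein E0 subr0.
have GYGY : G * Y * G * Y = 1.
  apply: eq_acts (actsM (actsM (actsM gG yY) gG) yY) a1 _ => k.
  by rewrite -!mulrA gygy_power mul1r.
have LM : rho^-1 - rho = q - q^-1 by rewrite rho_q omega0 sub0r mulrN1 opprB.
have G0 : G *m delta_mx 0 0 = rho^-1 *: delta_mx 0 0 :> 'cV[S]_d.
  apply: (acts_vec indep gG).
  by rewrite vec_delta mul1r (BMW2_ge rels) -quot_scalerAl mul1r.
have GP := Pk _ _ G0.
have u_unit : u \is a GRing.unit by rewrite w_unit ?mem_head.
have block := block_relations (mulrV rho_unit) LM u_unit GGi GiG skein0 YYi YiY
  GYGY GP Py PP lP lY erefl erefl.
pose iota : {rmorphism S -> 'M['M[S]_d]_3} := @scalar_mx 'M[S]_d 3 \o in_alg 'M[S]_d.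
rewrite omega0 => c c0.
have := @BMW2_eval S _ iota (@scalar_block_comm _ _) _ _ _ _ _ _ _ _ _ block _ c c0.
move=> /block_power_entry c1 j.
have PG0 : (P * Gi) *m delta_mx 0 0 = rho *: delta_mx 0 0 :> 'cV[S]_d.
  have Gi0 : Gi *m delta_mx 0 0 = rho *: delta_mx 0 0 :> 'cV[S]_d.
    rewrite -[delta_mx 0 0 in LHS]scale1r -(mulrV rho_unit) -scalerA -G0.
    by rewrite -scalemxAr mulmxA -[Gi *m G]/(Gi * G) GiG mul1mx.
  by rewrite -mulmxA Gi0 -scalemxAr P0.
have /eqP := vanishing_combination Yd PG0 c1 j; rewrite mulf_eq0.
by case/orP => [/eqP r0|/eqP //]; move: rho_unit; rewrite r0 unitr0.
Qed.
End NonDegenerateDescent.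

Theorem lemma5p5 (S : idomainType) (r d : nat) (u : r.-tuple S)
    (omega : nat -> S) :
  let p0 : {poly S} := \prod_(a <- take d u) ('X - a%:P) in
  (torsion_free (left_ideal (dBMW2_e1 omega u)) ->
   dBMW_semi_admissible omega u d ->
   (\sum_(j < d.+1) p0`_j *: dBMW2_y1 omega u ^+ j) * dBMW2_e1 omega u = 0 ->
   (forall l : nat, \sum_(j < d.+1) p0`_j * omega (j + l)%N = 0) /\
   dBMW_admissible omega (take d u))
  /\
  (forall rho q : S,
   BMW_parameters rho q omega u ->
   torsion_free (left_ideal (BMW2_e1 rho q omega u)) ->
   BMW_semi_admissible rho q omega u d ->
   (\sum_(j < d.+1) p0`_j *: BMW2_y1 rho q omega u ^+ j)
     * BMW2_e1 rho q omega u = 0 ->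
   (forall l : nat, \sum_(j < d.+1) p0`_j * omega (j + l)%N = 0) /\
   BMW_admissible rho q omega (take d u)).
Proof.
move=> p0; split.
  move=> _ [/andP[d_gt0 d_lt] indep _] pye.
  have rels := cyc_dBMW2_relations omega u.
  split.
    apply: omega_recurrence indep d_gt0 pye => a.
    by rewrite (dBMW2_eye rels) -quot_scalerAl mul1r.
  have := size_takel (ltnW d_lt); rewrite /p0 in pye *.
  move: (take d u) pye => [|b l] /= pye sz; first by rewrite -sz in d_gt0.
  by subst d; apply: dBMW2_descent rels indep pye.
move=> rho q [rho_unit _ u_unit rho_q] _ [/andP[d_gt0 d_lt] indep _] pye.
have rels := cyc_BMW2_relations rho q omega u.
split.
  apply: omega_recurrence indep d_gt0 pye => a.
  by rewrite (BMW2_eye rels) -quot_scalerAl mul1r.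
have := size_takel (ltnW d_lt); have : {in take d u, forall a, a \is a GRing.unit}.
  by move=> a /mem_take; apply: u_unit.
rewrite /p0 in pye *.
move: (take d u) pye => [|b l] /= pye w_unit sz; first by rewrite -sz in d_gt0.
by subst d; apply: BMW2_descent rels rho_unit w_unit rho_q indep pye.
Qed.
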